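(* Suppose $\widetilde{\bm f}_h^{n+1}=\bm 0$ for all $n$, and let $J=2$. Then the scheme (AC) described in the context satisfies the modified discrete energy law $$\mathscr{E}^N+\tau\sum_{k=2}^N\mathscr{P}^k\le C\qquad\text{for all } N\ge2\text{ (with } N\tau\le T),$$ where $C$ is a constant depending only on the initial data and the dimensionless numbers (see the context), and $$\mathscr{E}^n=\frac12\|(\widetilde{\sigma}\bm{u})_h^n\|^2+\frac{\mathrm{Cn}}{2\mathrm{We}}\|\nabla\phi_h^n\|^2+\frac{s}{2\mathrm{We}\,\mathrm{Cn}}\|\phi_h^n\|^2+\frac{1}{\mathrm{We}\,\mathrm{Cn}}|R^n|^2+\frac12|Q^n|^2+\frac{\zeta}{2}\|\nabla\cdot\bm{u}_h^n\|^2+\frac{2\tau^2}{9\varrho}\|P_h^n\|^2,$$ $$\mathscr{P}^n=\frac{4}{3\mathrm{Re}}\|(\widetilde{\eta}_h^n)^{1/2}\mathbb{D}(\bm{u}_h^n)\|^2+\frac{2}{3T}|Q^n|^2+\frac{2}{3\mathrm{Pe}\,\mathrm{We}\,\mathrm{Cn}}\|\nabla\mu_h^n\|^2+\frac{2\tau}{9\varrho}\|\mathscr{D}P_h^{n-1}\|^2.$$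
   Context: Domain and spaces. $\Omega\subset\mathbb{R}^d$ ($d=2,3$) is a bounded connected Lipschitz domain; $(\cdot,\cdot)$, $\|\cdot\|$ are the $L^2(\Omega)$ inner product and norm, $\|\cdot\|_1$ the $H^1(\Omega)$ norm. On a quasi-uniform triangulation of mesh size $h$ let $V_h\subset H^1(\Omega)$, $\bm X_h\subset H^1_0(\Omega)^d$, $N_h\subset H^1(\Omega)$ be conforming (continuous piecewise polynomial, finite dimensional) finite element spaces, $M_h=N_h\cap L^2_0(\Omega)$, with the inf-sup condition $\inf_{0\ne q\in M_h}\sup_{0\ne\bm v\in\bm X_h}\frac{(\nabla\cdot\bm v,q)}{\|\bm v\|_1\|q\|}\ge C_0>0$, $C_0$ independent of $h$. Parameters. $\mathrm{Cn},\mathrm{Pe},\mathrm{Re},\mathrm{We},\mathrm{Fr}>0$ (dimensionless numbers), $\rho_1,\rho_2,\eta_1,\eta_2,\rho_r,\eta_r>0$, $s,S>0$, final time $T>0$, uniform time step $\tau$ ($T/\tau$ a positive integer), $t^n=n\tau$; $\varrho=\min(\rho_1,\rho_2)/\rho_r$ and $\zeta\ge3\varrho$ is fixed. $F(\phi)=\frac14(\phi^2-1)^2$, $G(\phi)=F(\phi)-\frac s2\phi^2$; $S$ is such that $\int_\Omega G(\phi)\,\mathrm{d}\bm x+S>0$ for all relevant $\phi$. The mobility is constant, normalized to $m=1$. Time notation, for a generic quantity $\chi$: $\delta_\tau\chi^{n+1}=(\gamma_0\chi^{n+1}-\hat\chi)/\tau$, where for $J=1$: $\gamma_0=1$, $\hat\chi=\chi^n$,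 and the extrapolation is $\widetilde\chi^{n+1}=\chi^n$; for $J=2$: $\gamma_0=\frac32$, $\hat\chi=2\chi^n-\frac12\chi^{n-1}$, $\widetilde\chi^{n+1}=2\chi^n-\chi^{n-1}$. Also $\mathscr D\chi^{n+1}=\chi^{n+1}-\chi^n$. Coefficients. $\widetilde\phi_h^{n+1},\widetilde\mu_h^{n+1},\widetilde{\bm u}_h^{n+1}$ are the extrapolations. With the cut-off $\phi^{\mathscr C}=\phi$ if $|\phi|\le1$ and $\phi^{\mathscr C}=\mathrm{sign}(\phi)$ otherwise, set $\rho(\phi)=\frac{\rho_1-\rho_2}{2\rho_r}\phi^{\mathscr C}+\frac{\rho_1+\rho_2}{2\rho_r}$, $\eta(\phi)=\frac{\eta_1-\eta_2}{2\eta_r}\phi^{\mathscr C}+\frac{\eta_1+\eta_2}{2\eta_r}$, $\sigma=\sqrt\rho$, $U(\phi)=\sqrt{\int_\Omega G(\phi)\,\mathrm{d}\bm x+S}$, and $\widetilde\rho_h^{n+1}=\rho(\widetilde\phi_h^{n+1})$, $\widetilde\eta_h^{n+1}=\eta(\widetilde\phi_h^{n+1})$, $\widetilde\sigma_h^{n+1}=\sigma(\widetilde\phi_h^{n+1})$, $\widetilde U^{n+1}=U(\widetilde\phi_h^{n+1})$, $\widetilde{\bm J}_h^{n+1}=-\frac{\rho_1-\rho_2}{2\rho_r\mathrm{Pe}}\nabla\widetilde\mu_h^{n+1}$; $(\widetilde\sigma\bm u)_h^n=\widetilde\sigma_h^n\bm u_h^n$ with $\widetilde\sigma_h^0=\sigma(\phi_h^0)$.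 $\mathbb D(\bm u)=\frac12(\nabla\bm u+\nabla\bm u^T)$; $\widetilde{\bm f}_h^{n+1}\in L^2(\Omega)^d$ is the gravity force evaluated at $\widetilde\rho_h^{n+1}$. Further $\xi_1^{n+1}=R^{n+1}/\widetilde U^{n+1}$, $\xi_2^{n+1}=e^{t^{n+1}/T}Q^{n+1}$. Write $\widetilde{\bm w}=\widetilde\rho_h^{n+1}\widetilde{\bm u}_h^{n+1}+\widetilde{\bm J}_h^{n+1}$ and $\mathcal B^{n+1}(\bm v)=(\widetilde{\bm w}\cdot\nabla\widetilde{\bm u}_h^{n+1},\bm v)-(\widetilde{\bm w}\cdot\nabla\bm v,\widetilde{\bm u}_h^{n+1})$, where $(\bm w\cdot\nabla\bm u)_i=\sum_j w_j\partial_ju_i$. Scheme (AC): $(\phi_h^{n+1},\mu_h^{n+1})\in V_h\times V_h$, $\bm u_h^{n+1}\in\bm X_h$, $P_h^{n+1}\in N_h$, $R^{n+1},Q^{n+1}\in\mathbb R$ satisfy, for all $(\psi_h,\omega_h)\in V_h\times V_h$, $\bm v_h\in\bm X_h$, $q_h\in N_h$: (i) $(\delta_\tau\phi_h^{n+1},\omega_h)=\xi_1^{n+1}(\widetilde\phi_h^{n+1}\widetilde{\bm u}_h^{n+1},\nabla\omega_h)-\frac1{\mathrm{Pe}}(\nabla\mu_h^{n+1},\nabla\omega_h)$; (ii) $(\mu_h^{n+1},\psi_h)=\mathrm{Cn}^2(\nabla\phi_h^{n+1},\nabla\psi_h)+s(\phi_h^{n+1},\psi_h)+\xi_1^{n+1}(G'(\widetilde\phi_h^{n+1}),\psi_h)$;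 (iii) $\delta_\tau R^{n+1}=\frac1{2\widetilde U^{n+1}}\big((G'(\widetilde\phi_h^{n+1}),\delta_\tau\phi_h^{n+1})-(\widetilde\phi_h^{n+1}\widetilde{\bm u}_h^{n+1},\nabla\mu_h^{n+1})+(\widetilde\phi_h^{n+1}\nabla\widetilde\mu_h^{n+1},\bm u_h^{n+1})\big)$; (iv) $(\widetilde\sigma_h^{n+1}\delta_\tau(\widetilde\sigma\bm u)_h^{n+1},\bm v_h)+\zeta(\nabla\cdot\delta_\tau\bm u_h^{n+1},\nabla\cdot\bm v_h)+\frac2{\mathrm{Re}}(\widetilde\eta_h^{n+1}\mathbb D(\bm u_h^{n+1}),\mathbb D(\bm v_h))=-\frac{\xi_2^{n+1}}2\mathcal B^{n+1}(\bm v_h)+(P_h^\sharp,\nabla\cdot\bm v_h)-\frac{\xi_1^{n+1}}{\mathrm{We}\,\mathrm{Cn}}(\widetilde\phi_h^{n+1}\nabla\widetilde\mu_h^{n+1},\bm v_h)+\frac1{\mathrm{Fr}}(\widetilde{\bm f}_h^{n+1},\bm v_h)$; (v) $(\mathscr DP_h^{n+1},q_h)=-\frac{\gamma_0\varrho}\tau(\nabla\cdot\bm u_h^{n+1},q_h)$; (vi) $\delta_\tau Q^{n+1}=-\frac{Q^{n+1}}T+\frac12e^{t^{n+1}/T}\mathcal B^{n+1}(\bm u_h^{n+1})$. For $J=2$ these equations are used with $J=2$ for all $n\ge1$, with $P_h^\sharp=\frac13(7P_h^n-5P_h^{n-1}+P_h^{n-2})$ for $n\ge2$ and $P_h^\sharp=2P_h^1-P_h^0$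 for $n=1$. The first time level ($n=0$) is computed by the equations with $J=1$ and $P_h^\sharp=P_h^0$, except that the pressure $P_h^1$ is obtained from (v) with $\gamma_0=\frac32$, i.e. $(P_h^1-P_h^0,q_h)=-\frac{3\varrho}{2\tau}(\nabla\cdot\bm u_h^1,q_h)$ for all $q_h\in N_h$. Initial data: $\phi_h^0,\mu_h^0\in V_h$, $\bm u_h^0\in\bm X_h$, $P_h^0\in N_h$, $R^0=\sqrt{\int_\Omega G(\phi^0)\,\mathrm{d}\bm x+S}$ ($\phi^0$ the initial order parameter), $Q^0=1$. ''Depending only on the initial data and the dimensionless numbers'' means that $C$ may depend on these initial data, the dimensionless numbers and the fixed parameters listed above ($\rho_i,\eta_i,\rho_r,\eta_r,s,S,\zeta,T$), but not on $\tau$ or $N$. *)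

(* Defs.v *)
From HB Require Import structures.
From mathcomp Require Import all_boot all_order all_algebra.
From mathcomp Require Import all_classical all_reals all_analysis.
Set Implicit Arguments.
Unset Strict Implicit.
Unset Printing Implicit Defensive.
Import Order.TTheory GRing.Theory Num.Theory.
Import numFieldNormedType.Exports.
Local Open Scope classical_set_scope.
Local Open Scope ring_scope.

(* Matrices over R carry the sigma-algebra generated by the entries, i.e. the
   Borel sets of R^(m * n). *)
Section measurable_matrix.
Context {R : realType} (m n : nat).

Definition mx_sigma : set (set 'M[R]_(m, n)) :=
  <<s [set A | exists i j (B : set R),
         measurable B /\ A = [set v : 'M[R]_(m, n) | B (v i j)] ] >>.

Let mx_sigma0 : mx_sigma set0.
Proof. exact: sigma_algebra0. Qed.

Let mx_sigmaC A : mx_sigma A -> mx_sigma (~` A).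
Proof. exact: sigma_algebraC. Qed.

Let mx_sigma_bigcup (F : (set 'M[R]_(m, n))^nat) :
  (forall i, mx_sigma (F i)) -> mx_sigma (\bigcup_i F i).
Proof. exact: sigma_algebra_bigcup. Qed.

HB.instance Definition _ := @isMeasurable.Build default_measure_display
  'M[R]_(m, n) mx_sigma mx_sigma0 mx_sigmaC mx_sigma_bigcup.

End measurable_matrix.

Section mxlebesgue.
Context {R : realType}.

Lemma measurable_coord m n (i : 'I_m) (j : 'I_n) :
  measurable_fun setT (fun v : 'M[R]_(m, n) => v i j).
Proof.
move=> _ B mB; rewrite setTI; apply: sub_sigma_algebra.
by exists i, j, B.
Qed.

Lemma measurable_mxP d (T : measurableType d) m n (f : T -> 'M[R]_(m, n)) :
  (forall i j, measurable_fun setT (fun x => f x i j)) ->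
  measurable_fun setT f.
Proof.
move=> mf.
apply: (@measurability _ _ T 'M[R]_(m, n) setT f
  [set A | exists i j (B : set R),
         measurable B /\ A = [set v : 'M[R]_(m, n) | B (v i j)] ]) => //.
move=> _ [_ [i [j [B [mB ->]]]] <-].
exact: (mf i j).
Qed.

Definition rV_cons n (p : R * 'rV[R]_n) : 'rV[R]_n.+1 :=
  \row_(j < n.+1) oapp (p.2 0) p.1 (unlift 0 j).

Definition rV_uncons n (v : 'rV[R]_n.+1) : R * 'rV[R]_n :=
  (v 0 0, \row_(j < n) v 0 (lift 0 j)).

Lemma rV_consK n : cancel (@rV_cons n) (@rV_uncons n).
Proof.
case=> a v; rewrite /rV_uncons /rV_cons; congr pair => /=.
  by rewrite mxE unlift_none.
by apply/rowP => j; rewrite !mxE liftK.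
Qed.

Lemma measurable_rV_cons n : measurable_fun setT (@rV_cons n).
Proof.
apply: measurable_mxP => i j; rewrite (ord1 i).
under eq_fun do rewrite /= mxE.
case: (unliftP 0 j) => [k _|_] /=; last exact: measurable_fst.
apply: (@measurableT_comp _ _ _ _ _ _ (fun v : 'rV[R]_n => v 0 k)) => //.
exact: measurable_coord.
Qed.

Lemma measurable_rV_uncons n : measurable_fun setT (@rV_uncons n).
Proof.
apply/measurable_fun_pairP; split; first exact: measurable_coord.
apply: measurable_mxP => i j.
under eq_fun do rewrite /= mxE.
exact: measurable_coord.
Qed.

Section step.
Variables (n : nat) (mu : {sigma_finite_measure set 'rV[R]_n -> \bar R}).

Definition lebesgue_step : set 'rV[R]_n.+1 -> \bar R :=
  pushforward (lebesgue_measure \x mu)%E (@rV_cons n).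

Let mcons := @measurable_rV_cons n.

Let step0 : lebesgue_step set0 = 0%E.
Proof. exact: measure0. Qed.

Let step_ge0 A : (0 <= lebesgue_step A)%E.
Proof. exact: measure_ge0. Qed.

Let step_sigma_additive : semi_sigma_additive lebesgue_step.
Proof. exact: measure_semi_sigma_additive. Qed.

HB.instance Definition _ := isMeasure.Build _ _ _ lebesgue_step
  step0 step_ge0 step_sigma_additive.

Let step_sigma_finite : sigma_finite setT lebesgue_step.
Proof.
have /sigma_finiteP[F [TF ndF Foo]] : sigma_finite setT (@lebesgue_measure R).
  exact: sigma_finiteT.
have /sigma_finiteP[G [TG ndG Goo]] := sigma_finiteT mu.
exists (fun k => @rV_uncons n @^-1` (F k `*` G k)).
  rewrite -preimage_bigcup -[LHS](preimage_setT (@rV_uncons n)); congr (_ @^-1` _).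
  rewrite -setXTT TF TG predeqE => -[x y]; split.
    move=> [/= [i _ Fx] [k _ Gy]]; exists (maxn i k) => //; split.
    - by move: x Fx; exact/subsetPset/ndF/leq_maxl.
    - by move: y Gy; exact/subsetPset/ndG/leq_maxr.
  by move=> [i _ []/= ? ?]; split; exists i.
move=> k; have [mF Fk] := Foo k; have [mG Gk] := Goo k; split.
  rewrite -[X in measurable X]setTI; apply: measurable_rV_uncons => //.
  exact: measurableX.
rewrite /lebesgue_step /pushforward -comp_preimage.
rewrite (_ : _ \o _ = id); last by apply/funext => p /=; rewrite rV_consK.
by rewrite preimage_id product_measure1E// lte_mul_pinfty// ge0_fin_numE.
Qed.

HB.instance Definition _ := Measure_isSigmaFinite.Build _ _ _ lebesgue_step
  step_sigma_finite.

End step.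

(* Lebesgue measure on R^n, as the n-fold product of the one on R. *)
Fixpoint lebesgue_rV (n : nat) : {sigma_finite_measure set 'rV[R]_n -> \bar R} :=
  match n with
  | 0 => \d_(0 : 'rV[R]_0)
  | n'.+1 => lebesgue_step (lebesgue_rV n')
  end.

End mxlebesgue.

Section domain.
Context {R : realType} {d : nat}.
Notation E := 'rV[R]_d.

Definition dotp (x y : E) : R := \sum_i x 0 i * y 0 i.

(* The library norm of 'rV[R]_d is the sup norm. *)
Definition enorm (x : E) : R := Num.sqrt (dotp x x).

(* Near every boundary point, Om is the strict epigraph in some direction nu of
   a Lipschitz function g of the coordinates orthogonal to nu. *)
Definition lipschitz_boundary (Om : set E) : Prop :=
  forall p, (closure Om `\` Om) p ->
  exists (r : R) (nu : E) (g : E -> R) (L : R),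
    [/\ 0 < r, enorm nu = 1,
        forall x t, g (x + t *: nu) = g x,
        forall x y, `|g x - g y| <= L * enorm (x - y) &
        forall x, enorm (x - p) < r -> (Om x <-> g x < dotp x nu)].

Definition lipschitz_domain (Om : set E) : Prop :=
  [/\ Om !=set0, open Om, bounded_set Om, connected Om & lipschitz_boundary Om].

Definition bary (l : 'rV[R]_d.+1) : Prop :=
  (forall i, 0 <= l 0 i) /\ \sum_i l 0 i = 1.

(* A simplex is given by the matrix whose rows are its d + 1 vertices. *)
Definition simplex (K : 'M[R]_(d.+1, d)) : set E :=
  [set x | exists2 l : 'rV[R]_d.+1, bary l & x = l *m K].

Definition nondegenerate (K : 'M[R]_(d.+1, d)) : bool :=
  row_free (row_mx K (const_mx 1 : 'cV[R]_d.+1)).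

Definition common_face (K K' : 'M[R]_(d.+1, d)) : set E :=
  [set x | exists2 l : 'rV[R]_d.+1,
     bary l /\ (forall i, l 0 i != 0 -> exists j, row i K = row j K')
     & x = l *m K].

Definition triangulation (Om : set E) (Th : seq 'M[R]_(d.+1, d)) : Prop :=
  [/\ forall K, K \in Th -> nondegenerate K,
      closure Om = \bigcup_(K in [set` Th]) simplex K,
      forall K K', K \in Th -> K' \in Th -> K != K' ->
        interior (simplex K) `&` interior (simplex K') = set0 &
      forall K K', K \in Th -> K' \in Th -> K != K' ->
        simplex K `&` simplex K' = common_face K K'].

(* h is the largest diameter, and every element contains a ball of radius
   c * h. *)
Definition quasi_uniform (Th : seq 'M[R]_(d.+1, d)) (h c : R) : Prop :=
  [/\ forall K x y, K \in Th -> simplex K x -> simplex K y -> enorm (x - y) <= h,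
      exists K x y, [/\ K \in Th, simplex K x, simplex K y & enorm (x - y) = h] &
      forall K, K \in Th ->
        exists x, forall y, enorm (y - x) < c * h -> simplex K y].

Definition polynomial_on (A : set E) (f : E -> R) : Prop :=
  exists (r : nat) (c : {ffun 'I_d -> 'I_r.+1} -> R),
    forall x, A x -> f x = \sum_a c a * \prod_i x 0 i ^+ a i.

Definition C0_piecewise_polynomial (Om : set E) (Th : seq 'M[R]_(d.+1, d))
    (f : E -> R) : Prop :=
  {within closure Om, continuous f} /\
  forall K, K \in Th -> polynomial_on (simplex K) f.

End domain.

Section sobolev.
Context {R : realType} {d : nat}.
Notation E := 'rV[R]_d.
Notation leb := (@lebesgue_rV R d).

(* An element of H^1 is represented by a pair (u, grad u) of functions on the
   whole of R^d, only the values on Om being relevant, so that the gradient is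
   part of the data and linear combinations are those of pairs.  For a vector
   field u, the Jacobian has (i, j) entry d_j u_i. *)
Definition sfield : Type := ((E -> R^o) * (E -> 'rV[R]_d))%type.
Definition vfield : Type := ((E -> 'rV[R]_d) * (E -> 'M[R]_d))%type.

Definition grad (u : sfield) : E -> 'rV[R]_d := u.2.
Definition jac (u : vfield) : E -> 'M[R]_d := u.2.
Definition vcomp (i : 'I_d) (u : vfield) : sfield :=
  (fun x => u.1 x 0 i, fun x => row i (jac u x)).
Definition div (u : vfield) : E -> R := fun x => \tr (jac u x).
Definition symgrad (u : vfield) : E -> 'M[R]_d :=
  fun x => 2^-1 *: (jac u x + (jac u x)^T).

Definition ip (Om : set E) (f g : E -> R) : R :=
  \int[leb]_(x in Om) (f x * g x).
Definition ipm m n (Om : set E) (f g : E -> 'M[R]_(m, n)) : R :=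
  \int[leb]_(x in Om) (\sum_i \sum_j f x i j * g x i j).
Definition nrm (Om : set E) (f : E -> R) : R := Num.sqrt (ip Om f f).
Definition nrmm m n (Om : set E) (f : E -> 'M[R]_(m, n)) : R :=
  Num.sqrt (ipm Om f f).

Definition L2 (Om : set E) (f : E -> R) : Prop :=
  measurable_fun Om f /\ leb.-integrable Om (fun x => (f x ^+ 2)%:E).
Definition L2m m n (Om : set E) (f : E -> 'M[R]_(m, n)) : Prop :=
  forall i j, L2 Om (fun x => f x i j).

Definition e_ (i : 'I_d) : E := delta_mx 0 i.

Fixpoint Ck (k : nat) (f : E -> R) : Prop :=
  continuous f /\
  if k is k'.+1 then
    forall i, (forall x, derivable f x (e_ i)) /\ Ck k' ('D_(e_ i) f)
  else True.

Definition test_fun (Om : set E) (f : E -> R) : Prop :=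
  (forall k, Ck k f) /\
  exists A, [/\ compact A, A `<=` Om & forall x, ~ A x -> f x = 0].

Definition H1 (Om : set E) (u : sfield) : Prop :=
  [/\ L2 Om u.1, L2m Om (grad u) &
      forall (i : 'I_d) psi, test_fun Om psi ->
        ip Om u.1 ('D_(e_ i) psi) = - ip Om (fun x => grad u x 0 i) psi].

Definition nrm1 (Om : set E) (u : sfield) : R :=
  Num.sqrt (nrm Om u.1 ^+ 2 + nrmm Om (grad u) ^+ 2).
Definition vnrm1 (Om : set E) (u : vfield) : R :=
  Num.sqrt (nrmm Om u.1 ^+ 2 + nrmm Om (jac u) ^+ 2).

Definition classical (psi : E -> R) : sfield :=
  (psi, fun x => \row_i 'D_(e_ i) psi x).

(* H^1_0 is the closure of the test functions in H^1. *)
Definition H10 (Om : set E) (u : sfield) : Prop :=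
  H1 Om u /\ forall eps, 0 < eps ->
    exists2 psi, test_fun Om psi & nrm1 Om (u - classical psi) < eps.

Definition fin_dim_subspace (V : lmodType R) (A : set V) : Prop :=
  [/\ A 0, forall (a : R) u v, A u -> A v -> A (a *: u + v) &
      exists m (b : 'I_m -> V), (forall i, A (b i)) /\
        forall v, A v -> exists c : 'I_m -> R, v = \sum_i c i *: b i].

Definition infsup (Om : set E) (X : set vfield) (M : set sfield) (c : R) : Prop :=
  (c%:E <= ereal_inf
    [set ereal_sup
       [set (ip Om (div v) q.1 / (vnrm1 Om v * nrm Om q.1))%R%:E
       | v in [set v | X v /\ vnrm1 Om v != 0%R]]
    | q in [set q | M q /\ nrm Om q.1 != 0%R]])%E.

End sobolev.
Arguments sfield : clear implicits.
Arguments vfield : clear implicits.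

Section finite_elements.
Context {R : realType} {d : nat}.

Record fe_spaces := FESpaces {
  mesh : seq 'M[R]_(d.+1, d) ;
  mesh_size : R ;
  Vh : set (sfield R d) ;
  Xh : set (vfield R d) ;
  Nh : set (sfield R d) }.

Definition Mh (Om : set 'rV[R]_d) (fe : fe_spaces) : set (sfield R d) :=
  [set q | Nh fe q /\ \int[lebesgue_rV d]_(x in Om) q.1 x = 0].

Definition conforming (Om : set 'rV[R]_d) (fe : fe_spaces) (cqu C0 : R) : Prop :=
  [/\ triangulation Om (mesh fe) /\ quasi_uniform (mesh fe) (mesh_size fe) cqu,
      fin_dim_subspace (Vh fe) /\ (forall v, Vh fe v ->
        H1 Om v /\ C0_piecewise_polynomial Om (mesh fe) v.1),
      fin_dim_subspace (Xh fe) /\ (forall v, Xh fe v -> forall i,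
        H10 Om (vcomp i v) /\
        C0_piecewise_polynomial Om (mesh fe) (vcomp i v).1),
      fin_dim_subspace (Nh fe) /\ (forall v, Nh fe v ->
        H1 Om v /\ C0_piecewise_polynomial Om (mesh fe) v.1) &
      infsup Om (Xh fe) (Mh Om fe) C0].

End finite_elements.
Arguments fe_spaces : clear implicits.

Section time.
Context {R : realType}.

Variant bdf := BDF1 | BDF2.

Definition gamma0 (J : bdf) : R := if J is BDF1 then 1 else 3 / 2.

(* [hat], [ext] and [dtau] at n are the quantities of time level n + 1. *)
Definition hat (V : lmodType R) (J : bdf) (chi : nat -> V) (n : nat) : V :=
  if J is BDF1 then chi n else 2 *: chi n - 2^-1 *: chi n.-1.
Definition ext (V : lmodType R) (J : bdf) (chi : nat -> V) (n : nat) : V :=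
  if J is BDF1 then chi n else 2 *: chi n - chi n.-1.
Definition dtau (V : lmodType R) (tau : R) (J : bdf) (chi : nat -> V) (n : nat)
    : V :=
  tau^-1 *: (gamma0 J *: chi n.+1 - hat J chi n).

(* The second-order scheme computes time level n + 1 with J = 1 for n = 0 and
   with J = 2 afterwards. *)
Definition bdf_at (n : nat) : bdf := if n is 0 then BDF1 else BDF2.

(* The extrapolation to time level m; at level 0 it is the initial value. *)
Definition tilde (V : lmodType R) (chi : nat -> V) (m : nat) : V :=
  if m is n.+1 then ext (bdf_at n) chi n else chi 0%N.

End time.

Record params (R : realType) := Params {
  Cn : R ; Pe : R ; Rey : R ; We : R ; Fr : R ;
  rho1 : R ; rho2 : R ; eta1 : R ; eta2 : R ; rhor : R ; etar : R ;
  ss : R ; SS : R ; zeta : R ; TT : R }.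

Section coefficients.
Context {R : realType} (p : params R).

Definition varrho : R := Num.min (rho1 p) (rho2 p) / rhor p.

Definition params_ok : Prop :=
  [/\ [/\ 0 < Cn p, 0 < Pe p, 0 < Rey p, 0 < We p & 0 < Fr p],
      [/\ 0 < rho1 p, 0 < rho2 p & 0 < rhor p],
      [/\ 0 < eta1 p, 0 < eta2 p & 0 < etar p],
      [/\ 0 < ss p, 0 < SS p & 0 < TT p] &
      3 * varrho <= zeta p].

Definition cutoff (x : R) : R := if `|x| <= 1 then x else Num.sg x.
Definition rho (x : R) : R :=
  (rho1 p - rho2 p) / (2 * rhor p) * cutoff x
  + (rho1 p + rho2 p) / (2 * rhor p).
Definition eta (x : R) : R :=
  (eta1 p - eta2 p) / (2 * etar p) * cutoff x
  + (eta1 p + eta2 p) / (2 * etar p).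
Definition sigma (x : R) : R := Num.sqrt (rho x).

Definition F (x : R) : R := 4^-1 * (x ^+ 2 - 1) ^+ 2.
Definition G (x : R) : R := F x - ss p / 2 * x ^+ 2.

End coefficients.

Section scheme.
Context {R : realType} {d : nat}.
Notation E := 'rV[R]_d.

(* [phi00] is the initial order parameter, the others are its discrete
   companions at time level 0. *)
Record initdata := InitData {
  phi00 : E -> R ;
  phi_init : sfield R d ;
  mu_init : sfield R d ;
  u_init : vfield R d ;
  P_init : sfield R d }.

Record discrete_sol := DiscreteSol {
  phi : nat -> sfield R d ;
  mu : nat -> sfield R d ;
  vel : nat -> vfield R d ;
  prs : nat -> sfield R d ;
  Rn : nat -> R^o ;
  Qn : nat -> R^o }.

Variables (Om : set E) (p : params R) (force : R -> E -> 'rV[R]_d) (tau : R).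

Definition GS (f : E -> R) : R :=
  \int[lebesgue_rV d]_(x in Om) G p (f x) + SS p.
Definition U (f : E -> R) : R := Num.sqrt (GS f).

Section coefficients_at.
Variables (w : discrete_sol) (m : nat).

Definition time_at : R := m%:R * tau.
Definition phit : E -> R := (tilde (phi w) m).1.
Definition mut : sfield R d := tilde (mu w) m.
Definition ut : vfield R d := tilde (vel w) m.
Definition rhot : E -> R := fun x => rho p (phit x).
Definition etat : E -> R := fun x => eta p (phit x).
Definition sigmat : E -> R := fun x => sigma p (phit x).
Definition Ut : R := U phit.
Definition Jt : E -> 'rV[R]_d :=
  fun x => - ((rho1 p - rho2 p) / (2 * rhor p * Pe p)) *: grad mut x.
Definition ft : E -> 'rV[R]_d := fun x => force (rhot x) x.
Definition wt : E -> 'rV[R]_d := fun x => rhot x *: ut.1 x + Jt x.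
Definition su : E -> 'rV[R]_d := fun x => sigmat x *: (vel w m).1 x.
Definition xi1 : R := Rn w m / Ut.
Definition xi2 : R := expR (time_at / TT p) * Qn w m.

(* The row w *m (jac u)^T is (w . grad) u. *)
Definition BB (v : vfield R d) : R :=
  ipm Om (fun x => wt x *m (jac ut x)^T) v.1
  - ipm Om (fun x => wt x *m (jac v x)^T) ut.1.

End coefficients_at.

Section step.
Variables (fe : fe_spaces R d) (w : discrete_sol).
(* [gP] is the BDF coefficient used in the pressure update. *)
Variables (J : bdf) (Psharp : E -> R) (gP : R) (n : nat).

Let phit1 := phit w n.+1.
Let ut1 := ut w n.+1.
Let gmut1 := grad (mut w n.+1).
Let xi11 := xi1 w n.+1.
Let xi21 := xi2 w n.+1.
Let dphi : E -> R := (dtau tau J (phi w) n).1.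

Definition eq_phi : Prop := forall om, Vh fe om ->
  ip Om dphi om.1
  = xi11 * ipm Om (fun x => phit1 x *: ut1.1 x) (grad om)
    - (Pe p)^-1 * ipm Om (grad (mu w n.+1)) (grad om).

Definition eq_mu : Prop := forall psi, Vh fe psi ->
  ip Om (mu w n.+1).1 psi.1
  = Cn p ^+ 2 * ipm Om (grad (phi w n.+1)) (grad psi)
    + ss p * ip Om (phi w n.+1).1 psi.1
    + xi11 * ip Om (fun x => derive1 (G p) (phit1 x)) psi.1.

Definition eq_R : Prop :=
  dtau tau J (Rn w) n
  = (2 * Ut w n.+1)^-1 *
    (ip Om (fun x => derive1 (G p) (phit1 x)) dphi
     - ipm Om (fun x => phit1 x *: ut1.1 x) (grad (mu w n.+1))
     + ipm Om (fun x => phit1 x *: gmut1 x) (vel w n.+1).1).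

Definition eq_u : Prop := forall v, Xh fe v ->
  ipm Om (fun x => sigmat w n.+1 x *: dtau tau J (su w) n x) v.1
  + zeta p * ip Om (div (dtau tau J (vel w) n)) (div v)
  + 2 / Rey p * ipm Om (fun x => etat w n.+1 x *: symgrad (vel w n.+1) x)
                       (symgrad v)
  = - (xi21 / 2) * BB w n.+1 v
    + ip Om Psharp (div v)
    - xi11 / (We p * Cn p) * ipm Om (fun x => phit1 x *: gmut1 x) v.1
    + (Fr p)^-1 * ipm Om (ft w n.+1) v.1.

Definition eq_P : Prop := forall q, Nh fe q ->
  ip Om (prs w n.+1 - prs w n).1 q.1
  = - (gP * varrho p / tau) * ip Om (div (vel w n.+1)) q.1.

Definition eq_Q : Prop :=
  dtau tau J (Qn w) n
  = - (Qn w n.+1 / TT p)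
    + 2^-1 * expR (time_at n.+1 / TT p) * BB w n.+1 (vel w n.+1).

Definition in_spaces : Prop :=
  [/\ Vh fe (phi w n.+1), Vh fe (mu w n.+1), Xh fe (vel w n.+1)
    & Nh fe (prs w n.+1)].

Definition AC_step : Prop :=
  in_spaces /\ [/\ eq_phi, eq_mu & eq_R] /\ [/\ eq_u, eq_P & eq_Q].

End step.

Definition Psharp2 (w : discrete_sol) (n : nat) : sfield R d :=
  match n with
  | 0 => prs w 0
  | 1 => 2 *: prs w 1 - prs w 0
  | _ => 3^-1 *: (7 *: prs w n - 5 *: prs w n.-1 + prs w n.-2)
  end.

(* The first level is a J = 1 step whose pressure update uses the J = 2
   coefficient. *)
Definition AC2_step (fe : fe_spaces R d) (w : discrete_sol) (n : nat) : Prop :=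
  AC_step fe w (bdf_at n) (Psharp2 w n).1 (gamma0 BDF2) n.

Definition init_in_spaces (fe : fe_spaces R d) (i : initdata) : Prop :=
  [/\ Vh fe (phi_init i), Vh fe (mu_init i), Xh fe (u_init i)
    & Nh fe (P_init i)].

Definition starts_at (i : initdata) (w : discrete_sol) : Prop :=
  [/\ phi w 0 = phi_init i, mu w 0 = mu_init i, vel w 0 = u_init i,
      prs w 0 = P_init i & Rn w 0 = U (phi00 i) /\ Qn w 0 = 1].

Definition energy (w : discrete_sol) (n : nat) : R :=
  2^-1 * nrmm Om (su w n) ^+ 2
  + Cn p / (2 * We p) * nrmm Om (grad (phi w n)) ^+ 2
  + ss p / (2 * We p * Cn p) * nrm Om (phi w n).1 ^+ 2
  + (We p * Cn p)^-1 * `|Rn w n : R| ^+ 2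
  + 2^-1 * `|Qn w n : R| ^+ 2
  + zeta p / 2 * nrm Om (div (vel w n)) ^+ 2
  + 2 * tau ^+ 2 / (9 * varrho p) * nrm Om (prs w n).1 ^+ 2.

Definition dissipation (w : discrete_sol) (n : nat) : R :=
  4 / (3 * Rey p)
    * nrmm Om (fun x => Num.sqrt (etat w n x) *: symgrad (vel w n) x) ^+ 2
  + 2 / (3 * TT p) * `|Qn w n : R| ^+ 2
  + 2 / (3 * Pe p * We p * Cn p) * nrmm Om (grad (mu w n)) ^+ 2
  + 2 * tau / (9 * varrho p) * nrm Om (prs w n.-1 - prs w n.-2).1 ^+ 2.

End scheme.
Arguments initdata : clear implicits.
Arguments discrete_sol : clear implicits.

(* Main.v *)
Require Import Defs.
From mathcomp Require Import all_boot all_order all_algebra.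
From mathcomp Require Import all_classical all_reals all_analysis.
From mathcomp Require Import measurable_realfun ring lra.
Import Order.TTheory GRing.Theory Num.Theory.
Import numFieldNormedType.Exports.
Local Open Scope classical_set_scope.
Local Open Scope ring_scope.

(** Testing each equation of the scheme with the natural multiplier makes all
    nonlinear coupling terms cancel ([energy_balance]): if X^n collects the
    unknowns at level n and e is the quadratic energy form, then
      e (delta X^(n+1), X^(n+1)) + D^(n+1) = (P#, div u^(n+1)),
    where D is the physical dissipation and P# the extrapolated pressure.  What
    remains is a statement about a pressure-correction method in abstract
    semi-inner product spaces ([projection_stability]).

    Let a^n = P^n - P^(n-1).  The pressure update says that a^(n+1) is
    -3 rho / (2 tau) times the projection of div u^(n+1) onto the discrete
    pressures, so (P#, div u^(n+1)) = - 2 tau / (3 rho) (P#, a^(n+1)).  The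
    extrapolation satisfies P# = P^(n+1) - (2 tau / 3) delta a^(n+1)
    ([pressure_ext_dtau]).  The part P^(n+1) gives a telescoping difference of
    squared pressure norms and the dissipation of pressure increments.  The part
    delta a^(n+1) moves to the left, where it turns e into the modified form
      e (X, Y) - 4 tau^2 / (9 rho) (a_X, a_Y)
    on pairs of a state and its increment ([mod_form]).  Since a is a projected
    divergence, the subtracted square is at most rho |div u|^2, which the
    grad-div term zeta |div u|^2 of e absorbs because zeta >= 3 rho.  Hence the
    modified form is positive, and the G-stability identity of the two-step
    difference ([si_dtau2]) makes the modified energy decrease.

    This argument needs increments at three consecutive levels, each governed by
    the same pressure update, so it starts with the step to level 3.  On the
    first two levels the pressure work is bounded by Young's inequality; a
    factor tau is available there, and tau P^1 is bounded since tau a^1 is a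
    bounded multiple of a projected divergence.  Finally the modified energy
    controls the energy up to a constant factor. *)

(** * Semi-inner products and backward differences *)

Section subspace.
Context {R : realType} {V : lmodType R} (A : set V).
Hypothesis Acl : forall (a : R) u v, A u -> A v -> A (a *: u + v).

Lemma subspaceB u v : A u -> A v -> A (u - v).
Proof. by move=> Au Av; rewrite addrC -scaleN1r; exact: Acl. Qed.

Lemma subspaceZ (a : R) u : A u -> A (a *: u).
Proof.
by move=> Au; rewrite -[a *: u]addr0 -(subrr u); apply: Acl => //;
  exact: subspaceB.
Qed.

Lemma dtau_subspace (tau : R) J (chi : nat -> V) n :
  A (chi n.+1) -> A (chi n) -> A (chi n.-1) -> A (dtau tau J chi n).
Proof.
move=> A2 A1 A0; apply/subspaceZ/subspaceB; first exact: subspaceZ.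
by case: J => //=; apply: subspaceB; exact: subspaceZ.
Qed.

Lemma tilde_subspace (chi : nat -> V) m :
  (forall k, (k <= m)%N -> A (chi k)) -> A (tilde chi m).
Proof.
case: m => [|[|m]] Achi /=; [exact: Achi|exact: Achi|].
by apply: subspaceB; [apply: subspaceZ|]; apply: Achi => //; exact: leqW.
Qed.

End subspace.

(** The domain [D] is part of the structure because integral forms are bilinear
    only on square-integrable functions. *)
Record semi_inner (R : realType) (V : lmodType R) (D : set V)
    (b : V -> V -> R) : Prop := SemiInner {
  si_closed : forall (a : R) u v, D u -> D v -> D (a *: u + v) ;
  si_sym : forall u v, b u v = b v u ;
  si_lin : forall (a : R) u v w, D u -> D v -> D w ->
    b (a *: u + v) w = a * b u w + b v w ;
  si_ge0 : forall u, D u -> 0 <= b u u }.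
Arguments semi_inner {R V}.
Arguments si_closed {R V D b}.
Arguments si_sym {R V D b}.
Arguments si_lin {R V D b}.
Arguments si_ge0 {R V D b}.

Section semi_inner_theory.
Context {R : realType} {V : lmodType R} {D : set V} {b : V -> V -> R}.
Hypothesis sb : semi_inner D b.

Lemma si_combin (c0 c1 c2 : R) x y z : D x -> D y -> D z ->
  D (c0 *: x + c1 *: y + c2 *: z).
Proof.
move=> Dx Dy Dz; rewrite -addrA; do 2 apply: (si_closed sb) => //.
exact: (subspaceZ _ (si_closed sb)).
Qed.

Let lin3 (c0 c1 c2 : R) x y z w : D x -> D y -> D z -> D w ->
  b (c0 *: x + c1 *: y + c2 *: z) w = c0 * b x w + c1 * b y w + c2 * b z w.
Proof.
move=> Dx Dy Dz Dw; have Dz2 := subspaceZ _ (si_closed sb) c2 z Dz.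
have D0 : D 0 by rewrite -(subrr z); exact: (subspaceB _ (si_closed sb)).
rewrite -addrA !(si_lin sb)//; last exact: (si_closed sb).
have b0 : b 0 w = 0.
  by rewrite -(addNr x) -scaleN1r (si_lin sb)// mulN1r addNr.
have -> : b (c2 *: z) w = c2 * b z w.
  by rewrite -[_ *: _]addr0 (si_lin sb)// ?b0 ?addr0.
by rewrite addrA.
Qed.

Lemma si_combinE (c0 c1 c2 k0 k1 k2 : R) x y z : D x -> D y -> D z ->
  b (c0 *: x + c1 *: y + c2 *: z) (k0 *: x + k1 *: y + k2 *: z) =
  c0 * k0 * b x x + c1 * k1 * b y y + c2 * k2 * b z z
  + (c0 * k1 + c1 * k0) * b x y + (c0 * k2 + c2 * k0) * b x z
  + (c1 * k2 + c2 * k1) * b y z.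
Proof.
move=> Dx Dy Dz; rewrite lin3//; last exact: si_combin.
rewrite ![b _ (_ + _ + _)](si_sym sb) !lin3//.
rewrite (si_sym sb y x) (si_sym sb z x) (si_sym sb z y); ring.
Qed.

(** This is the G-stability of the two-step backward difference.  The last
    square on the right is numerical dissipation; the four before it telescope
    when the identity is summed over time levels. *)
Lemma si_dtau2 (tau : R) (X : nat -> V) n : tau != 0 ->
  D (X n.+2) -> D (X n.+1) -> D (X n) ->
  4 * tau * b (dtau tau BDF2 X n.+1) (X n.+2) =
  b (X n.+2) (X n.+2) + b (2 *: X n.+2 - X n.+1) (2 *: X n.+2 - X n.+1)
  - b (X n.+1) (X n.+1) - b (2 *: X n.+1 - X n) (2 *: X n.+1 - X n)
  + b (X n.+2 - 2 *: X n.+1 + X n) (X n.+2 - 2 *: X n.+1 + X n).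
Proof.
move=> tau0; rewrite /dtau /=.
move: (X n.+2) (X n.+1) (X n) => x y z Dx Dy Dz.
have E1 : tau^-1 *: ((3 / 2) *: x - (2 *: y - 2^-1 *: z)) =
  (tau^-1 * (3 / 2)) *: x + (tau^-1 * (- 2)) *: y + (tau^-1 * 2^-1) *: z.
  by rewrite !scalerBr !scalerA mulrN scaleNr opprB addrA addrAC.
have E2 : x = 1 *: x + 0 *: y + 0 *: z by rewrite !scale0r !addr0 scale1r.
have E3 : 2 *: x - y = 2 *: x + (-1) *: y + 0 *: z.
  by rewrite scale0r addr0 scaleN1r.
have E4 : 2 *: y - z = 0 *: x + 2 *: y + (-1) *: z.
  by rewrite scale0r add0r scaleN1r.
have E5 : x - 2 *: y + z = 1 *: x + (- 2) *: y + 1 *: z.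
  by rewrite !scale1r scaleNr.
rewrite E1 E3 E4 E5 [X in b _ X]E2 !si_combinE//.
by field.
Qed.

Lemma si_dtau1 (tau : R) (X : nat -> V) n : tau != 0 ->
  D (X n.+1) -> D (X n) ->
  2 * tau * b (dtau tau BDF1 X n) (X n.+1) =
  b (X n.+1) (X n.+1) - b (X n) (X n)
  + b (X n.+1 - X n) (X n.+1 - X n).
Proof.
move=> tau0; rewrite /dtau /= scale1r.
move: (X n.+1) (X n) => x y Dx Dy.
have E1 : x - y = 1 *: x + (-1) *: y + 0 *: y.
  by rewrite scale0r addr0 scale1r scaleN1r.
have E2 : tau^-1 *: (x - y) = tau^-1 *: x + (- tau^-1) *: y + 0 *: y.
  by rewrite scale0r addr0 scaleNr -scalerBr.
have E3 : x = 1 *: x + 0 *: y + 0 *: y by rewrite !scale0r !addr0 scale1r.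
rewrite E2 E1 [X in b _ X]E3 !si_combinE//.
by field.
Qed.

(** Young's inequality, obtained from positivity at [c *: x - y]. *)
Lemma si_young (c : R) x y : 0 < c -> D x -> D y ->
  2 * b x y <= c * b x x + c^-1 * b y y.
Proof.
move=> c0 Dx Dy.
have := si_ge0 sb _ (si_combin c (-1) 0 _ _ _ Dx Dy Dy).
rewrite si_combinE// => h.
rewrite -(ler_pM2l c0) mulrDr [c * (c^-1 * _)]mulrA mulfV ?gt_eqF//.
by lra.
Qed.

(** The parallelogram law with the square of the difference dropped. *)
Lemma si_combin_le (c0 c1 : R) x y : D x -> D y ->
  b (c0 *: x + c1 *: y) (c0 *: x + c1 *: y)
  <= 2 * c0 ^+ 2 * b x x + 2 * c1 ^+ 2 * b y y.
Proof.
move=> Dx Dy.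
have E k0 k1 : k0 *: x + k1 *: y = k0 *: x + k1 *: y + 0 *: y.
  by rewrite scale0r addr0.
have := si_ge0 sb _ (si_combin c0 (- c1) 0 _ _ _ Dx Dy Dy).
rewrite [c0 *: x + c1 *: y]E !si_combinE// => h; lra.
Qed.

End semi_inner_theory.

(** * Stability of a pressure-correction method with two-step differences *)

(** [Psharp2] in an arbitrary vector space, so that it also applies to the
    values of the pressure without its gradient. *)
Definition pressure_ext {R : realType} {W : lmodType R} (P : nat -> W)
    (n : nat) : W :=
  match n with
  | 0 => P 0%N
  | 1 => 2 *: P 1%N - P 0%N
  | _ => 3^-1 *: (7 *: P n - 5 *: P n.-1 + P n.-2)
  end.

Definition incr {R : realType} {W : lmodType R} (P : nat -> W) (n : nat) : W :=
  P n - P n.-1.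

(** The coefficients 7, -5, 1 are chosen for this identity: the extrapolated
    pressure differs from the new one by a backward difference of the pressure
    increments, to which the telescoping identity of the two-step scheme
    applies. *)
Lemma pressure_ext_dtau (R : realType) (W : lmodType R) (tau : R)
    (P : nat -> W) n : tau != 0 ->
  pressure_ext P n.+2
  = P n.+3 - (2 / 3 * tau) *: dtau tau BDF2 (incr P) n.+2.
Proof.
move=> tau0; rewrite /dtau /incr /=.
move: (P n.+3) (P n.+2) (P n.+1) (P n) => x y z t.
pose lc c0 c1 c2 c3 : W := c0 *: x + c1 *: y + c2 *: z + c3 *: t.
have lcZ a c0 c1 c2 c3 :
    a *: lc c0 c1 c2 c3 = lc (a * c0) (a * c1) (a * c2) (a * c3).
  by rewrite /lc !scalerDr !scalerA.
have lcD c0 c1 c2 c3 k0 k1 k2 k3 : lc c0 c1 c2 c3 + lc k0 k1 k2 k3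
    = lc (c0 + k0) (c1 + k1) (c2 + k2) (c3 + k3).
  by rewrite /lc !scalerDl [LHS]addrACA; congr (_ + _);
     rewrite addrACA; congr (_ + _); rewrite addrACA.
have lcN c0 c1 c2 c3 : - lc c0 c1 c2 c3 = lc (- c0) (- c1) (- c2) (- c3).
  by rewrite /lc !scaleNr !opprD.
(* Both sides are expressed in the four levels and compared coefficientwise. *)
have -> : x = lc 1 0 0 0 by rewrite /lc !scale0r !addr0 scale1r.
have -> : y = lc 0 1 0 0 by rewrite /lc !scale0r !addr0 add0r scale1r.
have -> : z = lc 0 0 1 0 by rewrite /lc !scale0r !addr0 !add0r scale1r.
have -> : t = lc 0 0 0 1 by rewrite /lc !scale0r !add0r scale1r.
rewrite !(lcZ, lcN, lcD).
by congr lc; field.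
Qed.

(** Here [e] is the energy form on the discrete states, [L] the divergence of
    the velocity part of a state, [b] the L^2 product and [N] the space of
    discrete pressures. *)
Section stability.
Context {R : realType} {V W : lmodType R}.
Variables (DV : set V) (e : V -> V -> R) (DW : set W) (b : W -> W -> R).
Variables (N : set W) (L : V -> W).
Hypotheses (se : semi_inner DV e) (sb : semi_inner DW b).
Hypotheses (NDW : N `<=` DW).
Hypothesis Ncl : forall (a : R) u v, N u -> N v -> N (a *: u + v).
Hypothesis Llin : forall (a : R) u v, L (a *: u + v) = a *: L u + L v.
Hypothesis LD : forall u, DV u -> DW (L u).
Variables (rho tau : R).
Hypotheses (rho0 : 0 < rho) (tau0 : 0 < tau).
Hypothesis Le : forall u, DV u -> 3 * rho * b (L u) (L u) <= e u u.

(** Pairs of a state and a pressure increment linked by the pressure update: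
    up to the factor, the increment is the projection onto [N] of the
    divergence of the state. *)
Definition mod_dom : set (V * W) := [set u | [/\ DV u.1, N u.2 &
  forall q, N q -> b u.2 q = - (3 / 2 * rho / tau) * b (L u.1) q]].

(** The energy from which the contribution of the extrapolated pressure is
    subtracted.  Testing with the divergence turns the correction of the
    extrapolation into the same backward difference as in the energy, with the
    opposite sign. *)
Definition mod_form (u v : V * W) : R :=
  e u.1 v.1 - 4 * tau ^+ 2 / (9 * rho) * b u.2 v.2.

(** A projection does not increase the norm, so an increment is controlled by
    the divergence, and the divergence by the energy.  The time step times the
    pressure can then be bounded one increment after the other. *)
Lemma mod_dom_le u : mod_dom u ->
  4 * (tau ^+ 2 / rho * b u.2 u.2) <= 3 * e u.1 u.1.
Proof.
case: u => x a [/= Dx Na ha]; have DWa := NDW _ Na; have DLx := LD _ Dx.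
set k := 3 / 2 * rho / tau in ha.
have k0 : 0 < k by rewrite divr_gt0// mulr_gt0// divr_gt0.
have : 0 <= k ^+ 2 * b (L x) (L x) - b a a.
  have haa := ha _ Na.
  have := si_ge0 sb _ (si_combin sb 1 k 0 _ _ _ DWa DLx DLx).
  rewrite (si_combinE sb)// (si_sym sb a (L x)) => h; lra.
rewrite subr_ge0 => h.
have := Le _ Dx => hL.
have E : tau ^+ 2 / rho * (k ^+ 2 * b (L x) (L x))
    = 9 / 4 * rho * b (L x) (L x).
  by rewrite /k; field; rewrite ?gt_eqF.
have c0 : 0 <= tau ^+ 2 / rho by rewrite divr_ge0 ?sqr_ge0// ltW.
have := ler_wpM2l c0 h; rewrite E => h2; lra.
Qed.

(** Positivity is where the condition on the grad-div parameter enters: the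
    subtracted term is at most a third of the energy. *)
Lemma mod_form_semi_inner : semi_inner mod_dom mod_form.
Proof.
have c0 : 0 <= tau ^+ 2 / rho by rewrite divr_ge0 ?sqr_ge0// ltW.
split.
- move=> a [x c] [y d] [/= Dx Nc hc] [/= Dy Nd hd]; split => /=.
  + exact: (si_closed se).
  + exact: Ncl.
  + move=> q Nq; have Dq := NDW _ Nq.
    rewrite Llin (si_lin sb) ?(si_lin sb) ?hc ?hd//;
      do ?[exact: NDW | exact: LD]; ring.
- by move=> u v; rewrite /mod_form (si_sym se) (si_sym sb).
- move=> a [x c] [y d] [z g] [/= Dx Nc hc] [/= Dy Nd hd] [/= Dz Ng hg].
  rewrite /mod_form /= (si_lin se)// (si_lin sb); [ring|exact: NDW..].
- move=> u Du; have := mod_dom_le _ Du; case: u Du => x a [/= Dx Na ha].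
  rewrite /mod_form /=.
  have := si_ge0 se _ Dx; have := si_ge0 sb _ (NDW _ Na) => h0 h1 h2.
  have -> : 4 * tau ^+ 2 / (9 * rho) * b a a = 4 / 9 * (tau ^+ 2 / rho * b a a).
    by field; rewrite gt_eqF.
  lra.
Qed.

Variables (T : R) (X : nat -> V) (P : nat -> W) (Dis : nat -> R) (K : nat).
Hypothesis tauT : tau <= T.
Hypothesis XD : forall n, (n <= K)%N -> DV (X n).
Hypothesis PN : forall n, (n <= K)%N -> N (P n).
Hypothesis Dis0 : forall n, 0 <= Dis n.
Hypothesis balance : forall n, (n < K)%N ->
  e (dtau tau (bdf_at n) X n) (X n.+1) + Dis n.+1
  = b (pressure_ext P n) (L (X n.+1)).
Hypothesis projection : forall n q, (n < K)%N -> N q ->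
  b (P n.+1 - P n) q = - (3 / 2 * rho / tau) * b (L (X n.+1)) q.

Let E n := e (X n) (X n).
Let f n := e (2 *: X n - X n.-1) (2 *: X n - X n.-1).
Let pr n := tau ^+ 2 / rho * b (P n) (P n).
Let al n := tau ^+ 2 / rho * b (incr P n) (incr P n).
Let Y n := (X n, incr P n).
Let tn0 : tau != 0. Proof. by rewrite gt_eqF. Qed.
Let rn0 : rho != 0. Proof. by rewrite gt_eqF. Qed.
Let c0 : 0 <= tau ^+ 2 / rho.
Proof. by rewrite divr_ge0 ?sqr_ge0// ltW. Qed.

Let E0 n : (n <= K)%N -> 0 <= E n.
Proof. by move=> nK; apply: (si_ge0 se); exact: XD. Qed.
Let PD n : (n <= K)%N -> DW (P n).
Proof. by move=> nK; apply/NDW/PN. Qed.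
Let LXD n : (n <= K)%N -> DW (L (X n)).
Proof. by move=> nK; apply/LD/XD. Qed.
Let incrN n : (n <= K)%N -> N (incr P n).
Proof.
move=> nK; apply: (subspaceB _ Ncl); apply: PN => //.
exact: leq_trans (leq_pred n) nK.
Qed.
Let al0 n : (n <= K)%N -> 0 <= al n.
Proof.
by move=> nK; rewrite mulr_ge0//; apply: (si_ge0 sb); exact/NDW/incrN.
Qed.
Let pr0 n : (n <= K)%N -> 0 <= pr n.
Proof. by move=> nK; rewrite mulr_ge0//; apply: (si_ge0 sb); exact: PD. Qed.

Let YD n : (n < K)%N -> mod_dom (Y n.+1).
Proof.
by move=> nK; split => /=;
  [exact: XD|exact: incrN|move=> q Nq; exact: projection].
Qed.

Let al_le n : (n < K)%N -> 4 * al n.+1 <= 3 * E n.+1.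
Proof. by move=> nK; exact: mod_dom_le (YD _ nK). Qed.

Let pr_le n : (n < K)%N -> pr n.+1 <= 2 * al n.+1 + 2 * pr n.
Proof.
move=> nK; have Da := NDW _ (incrN _ nK); have Dp := PD _ (ltnW nK).
have := si_combin_le sb 1 1 _ _ Da Dp.
rewrite !scale1r {1 2}/incr /= subrK => /(ler_wpM2l c0).
by rewrite /pr /al; lra.
Qed.

Let f1_le : (0 < K)%N -> f 1 <= 8 * E 1 + 2 * E 0.
Proof.
move=> K0; have := si_combin_le se 2 (-1) _ _ (XD _ K0) (XD _ (ltnW K0)).
by rewrite scaleN1r => h; rewrite /f /E /=; lra.
Qed.

(* The first two levels are estimated directly, absorbing the pressure term
   into the energy by Young's inequality. *)
Let E1_le : (0 < K)%N -> E 1 <= 2 * E 0 + 4 / 3 * pr 0.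
Proof.
move=> K0; have X0 := XD _ (leq0n K); have X1 := XD _ K0.
have := balance _ K0; have := si_dtau1 se tau X 0 tn0 X1 X0.
have d0 : 0 <= e (X 1 - X 0) (X 1 - X 0).
  apply: (si_ge0 se); rewrite addrC -scaleN1r; exact: (si_closed se).
have c1 : 0 < 3 * rho / (2 * tau) by rewrite divr_gt0// mulr_gt0.
have := si_young sb _ _ _ c1 (LXD _ K0) (PD _ (leq0n K)).
have := Le _ X1; have := Dis0 1; rewrite (si_sym sb (L _) (P 0)) /=.
rewrite -/(E 1) -/(E 0).
move: (dtau _ _ _ _) (b (L _) _) (b (P 0) (L _)) d0 => D bd bp.
move=> d0 h1 h2 h3 h4 h5.
have h6 : 2 * tau * bp <= 3 / 2 * rho * bd + 2 / 3 * pr 0.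
  have := ler_wpM2l (ltW tau0) h3.
  rewrite (_ : tau * (_ + _) = 3 / 2 * rho * bd + 2 / 3 * pr 0); first lra.
  by rewrite /pr; field; rewrite tn0 rn0.
have h7 : 2 * tau * e D (X 1) <= 2 * tau * bp.
  by rewrite ler_wpM2l ?mulr_ge0 ?(ltW tau0)//; lra.
lra.
Qed.

Let step1_le : (1 < K)%N ->
  1 / 8 * E 2 + 1 / 4 * f 2 + tau * Dis 2 <=
  1 / 4 * (E 1 + f 1) + 2 / 3 * (8 * pr 1 + 2 * pr 0).
Proof.
move=> K1; have K0 := ltnW K1.
have X0 := XD _ (leq0n K); have X1 := XD _ K0; have X2 := XD _ K1.
have P0 := PD _ (leq0n K); have P1 := PD _ K0.
have := balance _ K1; have := si_dtau2 se tau X 0 tn0 X2 X1 X0.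
have d0 : 0 <= e (X 2 - 2 *: X 1 + X 0) (X 2 - 2 *: X 1 + X 0).
  apply: (si_ge0 se).
  by have := si_combin se 1 (-2) 1 _ _ _ X2 X1 X0; rewrite !scale1r scaleNr.
have DP : DW (2 *: P 1 - P 0).
  have := si_combin sb 2 (-1) 0 _ _ _ P1 P0 P0.
  by rewrite scale0r addr0 scaleN1r.
have c1 : 0 < 3 * rho / (4 * tau) by rewrite divr_gt0// mulr_gt0.
have := si_young sb _ _ _ c1 (LXD _ K1) DP.
have := Le _ X2; rewrite (si_sym sb (L _) (2 *: _ - _)) /=.
have := si_combin_le sb 2 (-1) _ _ P1 P0; rewrite scaleN1r.
rewrite -/(E 2) -/(E 1) -[e (2 *: X 2 - X 1) _]/(f 2).
rewrite -[e (2 *: X 1 - X 0) _]/(f 1).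
move: (dtau _ _ _ _) (b (L _) _) (b (_ - _) (L _)) d0 => D bd bp.
move: (b _ _) => bP d0 h0 h1 h2 h3 h4.
have h6 : 2 * tau * bp <= 3 / 4 * rho * bd + 4 / 3 * (tau ^+ 2 / rho * bP).
  have := ler_wpM2l (ltW tau0) h2.
  rewrite (_ : tau * (_ + _)
    = 3 / 4 * rho * bd + 4 / 3 * (tau ^+ 2 / rho * bP)); first lra.
  by field; rewrite tn0 rn0.
have := ler_wpM2l c0 h0.
move=> h7.
have h8 : tau * e D (X 2) + tau * Dis 2 = tau * bp by rewrite -mulrDr h4.
rewrite /pr; lra.
Qed.

(* From level 2 on, this quantity decreases; its first two terms are
   the squares that telescope for the modified form. *)
Let M n := 1 / 4 * (mod_form (Y n) (Y n)
  + mod_form (2 *: Y n - Y n.-1) (2 *: Y n - Y n.-1)) + 1 / 3 * pr n.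

Let mod_formE u : mod_form u u =
  e u.1 u.1 - 4 / 9 * (tau ^+ 2 / rho * b u.2 u.2).
Proof. by rewrite /mod_form; field. Qed.

Let M_ge n : (n.+1 < K)%N -> 1 / 6 * E n.+2 + 1 / 3 * pr n.+2 <= M n.+2.
Proof.
move=> nK; have D2 := YD _ nK; have D1 := YD _ (ltnW nK).
have := si_combin mod_form_semi_inner 2 (-1) 0 _ _ _ D2 D1 D1.
rewrite scale0r addr0 scaleN1r => /(si_ge0 mod_form_semi_inner) h.
have := al_le _ nK; rewrite /M (mod_formE (Y _)) /= -/(E _) -/(al _); lra.
Qed.

Let M2_le : (1 < K)%N -> M 2 <= 1 / 4 * (E 2 + f 2) + 1 / 3 * pr 2.
Proof.
move=> K1; rewrite /M !mod_formE /= -/(E 2) -/(f 2) -/(al 2).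
have := al0 _ K1.
have : DW (2 *: incr P 2 - incr P 1).
  have i2 := NDW _ (incrN _ K1); have i1 := NDW _ (incrN _ (ltnW K1)).
  have := si_combin sb 2 (-1) 0 _ _ _ i2 i1 i1.
  by rewrite scale0r addr0 scaleN1r.
move/(si_ge0 sb)/(mulr_ge0 c0); rewrite /f /=; lra.
Qed.

Let M_step n : (n.+2 < K)%N ->
  M n.+3 + tau * Dis n.+3 + 1 / 3 * al n.+3 <= M n.+2.
Proof.
move=> nK; have nK1 := ltnW nK; have nK0 := ltnW nK1.
have D3 := YD _ nK; have D2 := YD _ nK1; have D1 := YD _ nK0.
have sm := mod_form_semi_inner.
have := si_dtau2 sm tau Y n.+1 tn0 D3 D2 D1.
have : 0 <= mod_form (Y n.+3 - 2 *: Y n.+2 + Y n.+1)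
                     (Y n.+3 - 2 *: Y n.+2 + Y n.+1).
  apply: (si_ge0 sm).
  by have := si_combin sm 1 (-2) 1 _ _ _ D3 D2 D1; rewrite !scale1r scaleNr.
move: (mod_form (Y n.+3 - _ + _) _) => dd dd0.
have := balance _ nK; rewrite (pressure_ext_dtau _ _ _ _ _ tn0).
have [P3 P2] := (PN _ nK, PN _ nK1).
set a := incr P n.+3; set da := dtau tau BDF2 (incr P) n.+2.
have Na : N a by exact: incrN.
have Nda : N da.
  by apply: (dtau_subspace _ Ncl); exact: incrN.
have NP : N (P n.+3 - (2 / 3 * tau) *: da).
  by rewrite addrC -scaleNr; exact: Ncl.
(* The pressure term is rewritten with the increment [a]: the new pressure
   yields a telescoping pressure norm, the backward difference of increments
   the correction contained in the modified form. *)
have := projection _ _ nK NP.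
have -> : b (P n.+3 - P n.+2) (P n.+3 - (2 / 3 * tau) *: da)
  = 1 / 2 * (b (P n.+3) (P n.+3) - b (P n.+2) (P n.+2) + b a a)
    - 2 / 3 * tau * b da a.
  rewrite (si_sym sb) addrC -scaleNr (si_lin sb); [|exact: NDW..].
  rewrite mulNr addrC; congr (_ - _).
  have [Dp3 Dp2] := (NDW _ P3, NDW _ P2).
  have E1 : P n.+3 - P n.+2 = 1 *: P n.+3 + (-1) *: P n.+2 + 0 *: P n.+2.
    by rewrite scale0r addr0 scale1r scaleN1r.
  have E2 : P n.+3 = 1 *: P n.+3 + 0 *: P n.+2 + 0 *: P n.+2.
    by rewrite !scale0r !addr0 scale1r.
  rewrite {1}E2 /a /incr /= E1 !(si_combinE sb)//; lra.
rewrite (si_sym sb (L _)).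
move: (b _ (L _)) => bp h1 h2 h3.
have h4 : mod_form (dtau tau BDF2 Y n.+2) (Y n.+3)
  = e (dtau tau BDF2 X n.+2) (X n.+3) - 4 * tau ^+ 2 / (9 * rho) * b da a.
  by [].
rewrite /M /=.
have h5 : tau * bp = - (1 / 3 * (pr n.+3 - pr n.+2 + al n.+3))
    + tau * (4 * tau ^+ 2 / (9 * rho) * b da a).
  have -> : bp = - (2 / 3 * tau / rho) * (- (3 / 2 * rho / tau) * bp).
    by field; rewrite tn0 rn0.
  by rewrite -h1 /pr /al -/a; field.
have h6 : tau * e (dtau tau BDF2 X n.+2) (X n.+3) + tau * Dis n.+3 = tau * bp.
  by rewrite -mulrDr h2.
rewrite h4 in h3.
lra.
Qed.

(** The decrease of the modified energy from level 2 on is combined with the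
    direct estimates of levels 1 and 2.  The two constants only have to be large
    enough: three times the modified energy dominates the energy, and each of
    the first two steps loses a fixed factor. *)
Lemma projection_stability m : (2 <= m <= K)%N ->
  1 / 2 * e (X m) (X m) + 2 / 9 * (tau ^+ 2 / rho * b (P m) (P m))
  + tau * \sum_(2 <= k < m.+1) (2 / 3 * Dis k
      + 2 / 9 * (tau / rho * b (incr P k.-1) (incr P k.-1)))
  <= 500 * e (X 0) (X 0) + 600 * (T ^+ 2 / rho * b (P 0) (P 0)).
Proof.
move=> /andP[m2 mK].
have E2 n (t := \sum_(2 <= k < n) (2 / 3 * Dis k
      + 2 / 9 * (tau / rho * b (incr P k.-1) (incr P k.-1)))) :
   tau * t = \sum_(2 <= k < n) (2 / 3 * (tau * Dis k) + 2 / 9 * al k.-1).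
  by rewrite /t mulr_sumr; apply: eq_bigr => k _; rewrite /al; field.
rewrite E2.
have prT : pr 0 <= T ^+ 2 / rho * b (P 0) (P 0).
  rewrite /pr ler_wpM2r ?(si_ge0 sb) ?ler_wpM2r ?invr_ge0 ?(ltW rho0)//.
    exact: PD.
  by rewrite ler_sqr ?nnegrE ?(ltW tau0) ?(le_trans (ltW tau0)).
have [j mE] : exists j, m = j.+2 by exists m.-2; case: m m2 {mK} => [|[]].
move: mK; rewrite {m m2}mE => mK.
have main : 3 * M j.+2 + 2 / 9 * al j.+2
    + \sum_(2 <= k < j.+3) (2 / 3 * (tau * Dis k) + 2 / 9 * al k.-1)
  <= 500 * e (X 0) (X 0) + 600 * pr 0.
  elim: j mK => [|j ih] jK.
    have K0 := ltnW jK.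
    rewrite big_nat1 /=.
    have := M2_le jK; have := step1_le jK; have := E1_le K0; have := f1_le K0.
    have := al_le _ K0; have := al_le _ jK; have := pr_le _ K0.
    have := pr_le _ jK; have := pr0 _ K0; have := pr0 _ (leq0n K).
    have := E0 _ (leq0n K); have := E0 _ jK; have := E0 _ K0.
    have := al0 _ K0; have := al0 _ jK.
    have := mulr_ge0 (ltW tau0) (Dis0 2).
    have : 0 <= f 2.
      have [X2 X1] := (XD _ jK, XD _ K0).
      apply: (si_ge0 se); rewrite /f /=.
      have := si_combin se 2 (-1) 0 _ _ _ X2 X1 X1.
      by rewrite scale0r addr0 scaleN1r.
    rewrite -/(E 0); lra.
  rewrite big_nat_recr//=.
  have := ih (ltnW jK); have := M_step _ jK.
  have := mulr_ge0 (ltW tau0) (Dis0 j.+3); have := al0 _ jK.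
  lra.
have := M_ge _ mK; have := al0 _ mK; have := pr0 _ mK.
rewrite -/(E j.+2) -/(pr j.+2) => h0 h1 h2.
lra.
Qed.

End stability.

(** * Square-integrable fields *)

(** An open set is the union of the boxes with rational centre and radius that
    it contains, and a box is a finite intersection of preimages of intervals
    by the entries. *)
Lemma open_measurable_mx (R : realType) m n (A : set 'M[R]_(m, n)) :
  open A -> measurable A.
Proof.
move=> oA.
pose B (q : 'M[rat]_(m, n) * rat) : set 'M[R]_(m, n) :=
  \bigcap_(ij : 'I_m * 'I_n)
    [set v | `|ratr (q.1 ij.1 ij.2) - v ij.1 ij.2| < ratr q.2].
have mB q : measurable (B q).
  rewrite -[X in measurable X]setCK setC_bigcap; apply: measurableC.
  apply: countable_bigcupT_measurable; first exact: countableP.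
  move=> [i j]; apply: measurableC => /=.
  have mf : measurable_fun setT
      (fun v : 'M[R]_(m, n) => `|ratr (q.1 i j) - v i j| < ratr q.2).
    apply: measurable_fun_ltr => //.
    apply: measurableT_comp => //; apply: measurable_funB => //.
    exact: measurable_coord.
  have := mf measurableT [set true] ltac:(by []).
  by rewrite setTI preimage_true.
have -> : A = \bigcup_q (if `[< B q `<=` A >] then B q else set0).
  apply/seteqP; split => [x Ax|x [q _]]; last first.
    by case: asboolP => // sBA /sBA.
  have /nbhs_ballP[_ /posnumP[r] xrA] : nbhs x A by exact: open_nbhs_nbhs.
  have r4 : 0 < r%:num / 4 :> R by [].
  (* A rational radius between r/4 and r/2 and a centre within r/4 of x give a
     box that contains x and lies in the ball of radius r. *)
  have r42 : r%:num / 4 < r%:num / 2 :> R by lra.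
  have [q2] := rat_in_itvoo r42.
  rewrite in_itv /= => /andP[q2l q2r].
  have /choice[q1 q1P] : forall ij : 'I_m * 'I_n, exists q : rat,
      x ij.1 ij.2 < ratr q < x ij.1 ij.2 + r%:num / 4.
    move=> ij; have [q] := rat_in_itvoo (ltr_pwDr r4 (lexx (x ij.1 ij.2))).
    by rewrite in_itv /=; exists q.
  have q1x i j : `|ratr (q1 (i, j)) - x i j| < r%:num / 4.
    have /andP[/= h1 h2] := q1P (i, j).
    by rewrite ltr_norml; apply/andP; split; lra.
  exists (\matrix_(i, j) q1 (i, j), q2) => //.
  case: asboolP => [_|].
    by move=> [i j] _ /=; rewrite mxE; exact: lt_trans q2l.
  move=> nBA; exfalso; apply: nBA => v Bv; apply: xrA; split=> // i j.
  have := Bv (i, j) I; rewrite /= mxE => h1; have h2 := q1x i j.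
  rewrite /ball /= (_ : x i j - v i j =
    (ratr (q1 (i, j)) - v i j) - (ratr (q1 (i, j)) - x i j)); last by lra.
  rewrite (le_lt_trans (ler_normB _ _))//; lra.
apply: countable_bigcupT_measurable; first exact: countableP.
by move=> q; case: asboolP.
Qed.

Section L2_theory.
Context {R : realType} {d : nat}.
Variable Om : set 'rV[R]_d.
Hypothesis mOm : measurable Om.
Notation leb := (@lebesgue_rV R d).

Lemma L2_integrable f g : L2 Om f -> L2 Om g ->
  leb.-integrable Om (EFin \o (fun x => f x * g x)).
Proof.
move=> [mf If] [mg Ig].
apply: (le_integrable mOm _ _ (integrableD mOm If Ig)) => /=.
  by apply/measurable_EFinP; exact: measurable_funM.
move=> x _ /=; rewrite lee_fin.
rewrite [leRHS]ger0_norm ?addr_ge0 ?sqr_ge0//.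
rewrite normrM -(real_normK (num_real (f x))) -(real_normK (num_real (g x))).
have := sqr_ge0 (`|f x| - `|g x|); have := sqr_ge0 (`|f x| + `|g x|); lra.
Qed.

Lemma L2_comb (a : R) f g : L2 Om f -> L2 Om g ->
  L2 Om (fun x => a * f x + g x).
Proof.
move=> Lf Lg; have [[mf If] [mg Ig]] := (Lf, Lg).
split; first by apply: measurable_funD => //; exact: measurable_funM.
have -> : (fun x => ((a * f x + g x) ^+ 2)%:E) =
    (fun x => ((a ^+ 2)%:E * (f x ^+ 2)%:E
      + ((2 * a)%:E * (f x * g x)%:E + (g x ^+ 2)%:E))%E).
  by apply/funext => x; rewrite -!EFinM -!EFinD; congr EFin; ring.
apply: integrableD => //; first exact: integrableZl.
by apply: integrableD => //; apply: integrableZl => //; exact: L2_integrable.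
Qed.

Lemma ip_lin (a : R) f g h : L2 Om f -> L2 Om g -> L2 Om h ->
  ip Om (fun x => a * f x + g x) h = a * ip Om f h + ip Om g h.
Proof.
move=> Lf Lg Lh; rewrite /ip.
have If := L2_integrable _ _ Lf Lh; have Ig := L2_integrable _ _ Lg Lh.
rewrite -RintegralZl// -RintegralD//; last first.
  have := integrableZl mOm a If; congr (integrable _ _ _).
by apply: eq_Rintegral => x _; rewrite mulrDl mulrA.
Qed.

Lemma ip_semi_inner : semi_inner (V := 'rV[R]_d -> R^o) (L2 Om) (ip Om).
Proof.
split.
- move=> a u v; exact: L2_comb.
- by move=> u v; apply: eq_Rintegral => x _; rewrite mulrC.
- move=> a u v w; exact: ip_lin.
- by move=> u _; apply: Rintegral_ge0 => x _; rewrite -expr2 sqr_ge0.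
Qed.

Lemma L2_0 : L2 Om (fun _ => 0).
Proof.
split => //; under eq_fun do rewrite expr0n /=.
exact: integrable0.
Qed.

Lemma L2_sum (I : Type) (s : seq I) (F : I -> 'rV[R]_d -> R) :
  (forall i, L2 Om (F i)) -> L2 Om (fun x => \sum_(i <- s) F i x).
Proof.
move=> LF; elim: s => [|i s ih].
  by under eq_fun do rewrite big_nil; exact: L2_0.
have := L2_comb 1 _ _ (LF i) ih.
under eq_fun do rewrite mul1r.
by under [in X in _ -> X]eq_fun do rewrite big_cons.
Qed.

(** The bound is on the square of the factor, as this is what is known of a
    square root of the density. *)
Lemma L2_bounded_mul (c : R) (f g : 'rV[R]_d -> R) : measurable_fun Om f ->
  (forall x, f x ^+ 2 <= c) -> L2 Om g -> L2 Om (fun x => f x * g x).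
Proof.
move=> mf fc [mg Ig]; split; first exact: measurable_funM.
apply: (le_integrable mOm _ _ (integrableZl mOm c Ig)) => /=.
  by apply/measurable_EFinP/measurable_funX; exact: measurable_funM.
move=> x _ /=; rewrite lee_fin exprMn.
have c0 : 0 <= c by exact: le_trans (sqr_ge0 _) (fc x).
have fg0 : 0 <= f x ^+ 2 * g x ^+ 2 by apply: mulr_ge0; exact: sqr_ge0.
have cg0 : 0 <= c * g x ^+ 2 by apply: mulr_ge0 => //; exact: sqr_ge0.
by rewrite !ger0_norm// ler_wpM2r ?sqr_ge0.
Qed.

Lemma Rintegral_sum (I : Type) (s : seq I) (F : I -> 'rV[R]_d -> R) :
  (forall i, leb.-integrable Om (EFin \o F i)) ->
  \int[leb]_(x in Om) (\sum_(i <- s) F i x) =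
  \sum_(i <- s) \int[leb]_(x in Om) F i x.
Proof.
move=> IF; elim: s => [|i s ih].
  under eq_Rintegral do rewrite big_nil.
  by rewrite big_nil /Rintegral integral0.
under eq_Rintegral do rewrite big_cons.
rewrite big_cons RintegralD// ?ih//.
have := integrable_sum mOm s (P := xpredT) (fun i _ => IF i).
congr (integrable _ _ _).
by apply/funext => x /=; rewrite -sumEFin.
Qed.

(** Splitting into entries reduces bilinearity for fields to the scalar case;
    square-integrability is needed to exchange the integral and the sums. *)
Lemma ipmE m n (f g : 'rV[R]_d -> 'M[R]_(m, n)) : L2m Om f -> L2m Om g ->
  ipm Om f g = \sum_i \sum_j ip Om (fun x => f x i j) (fun x => g x i j).
Proof.
move=> Lf Lg; rewrite /ipm /ip.
have I i j := L2_integrable _ _ (Lf i j) (Lg i j).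
rewrite Rintegral_sum => [|i].
  by apply: eq_bigr => i _; rewrite Rintegral_sum.
have := integrable_sum mOm (index_enum 'I_n) (P := xpredT) (fun j _ => I i j).
congr (integrable _ _ _).
by apply/funext => x /=; rewrite -sumEFin.
Qed.

Lemma ipm_sym m n (f g : 'rV[R]_d -> 'M[R]_(m, n)) : ipm Om f g = ipm Om g f.
Proof.
apply: eq_Rintegral => x _; apply: eq_bigr => i _; apply: eq_bigr => j _.
exact: mulrC.
Qed.

Lemma ipm_ge0 m n (f : 'rV[R]_d -> 'M[R]_(m, n)) : 0 <= ipm Om f f.
Proof.
apply: Rintegral_ge0 => x _; apply: sumr_ge0 => i _; apply: sumr_ge0 => j _.
by rewrite -expr2 sqr_ge0.
Qed.

Lemma ip_ge0 (f : 'rV[R]_d -> R) : 0 <= ip Om f f.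
Proof. by apply: Rintegral_ge0 => x _; rewrite -expr2 sqr_ge0. Qed.

Lemma nrm_sqr (f : 'rV[R]_d -> R) : nrm Om f ^+ 2 = ip Om f f.
Proof. by rewrite sqr_sqrtr// ip_ge0. Qed.

Lemma nrmm_sqr m n (f : 'rV[R]_d -> 'M[R]_(m, n)) :
  nrmm Om f ^+ 2 = ipm Om f f.
Proof. by rewrite sqr_sqrtr// ipm_ge0. Qed.

Lemma ipm_semi_inner m n :
  semi_inner (V := 'rV[R]_d -> 'M[R]_(m, n)) (L2m Om) (@ipm R d m n Om).
Proof.
have cl (a : R) (u v : 'rV[R]_d -> 'M[R]_(m, n)) :
    L2m Om u -> L2m Om v -> L2m Om (a *: u + v).
  move=> Lu Lv i j; have := L2_comb a _ _ (Lu i j) (Lv i j).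
  by congr (L2 _ _); apply/funext => x; rewrite !mxE.
split => //.
- exact: ipm_sym.
- move=> a u v w Lu Lv Lw; rewrite !ipmE//; last exact: cl.
  rewrite mulr_sumr -big_split; apply: eq_bigr => i _.
  rewrite mulr_sumr -big_split; apply: eq_bigr => j _ /=.
  rewrite -ip_lin//; congr (ip _ _ _).
  by apply/funext => x; rewrite !mxE.
- by move=> u _; exact: ipm_ge0.
Qed.

Lemma ipm_ae0 m n (f g : 'rV[R]_d -> 'M[R]_(m, n)) : L2m Om f -> L2m Om g ->
  {ae leb, forall x, Om x -> f x = 0} -> ipm Om f g = 0.
Proof.
move=> Lf Lg f0; rewrite ipmE// big1// => i _; rewrite big1// => j _.
rewrite /ip /Rintegral (ae_eq_integral (cst 0%E))//.
- by rewrite integral0.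
- apply/measurable_EFinP.
  by apply: measurable_funM; [case: (Lf i j)|case: (Lg i j)].
- apply: filterS f0 => x fx0 Ox; rewrite fx0//.
  by rewrite mxE mul0r.
Qed.

End L2_theory.

(** * The coefficients and the energy form *)

Section coefficient_bounds.
Context {R : realType} (p : params R).
Hypothesis pok : params_ok p.

Lemma cutoffE (x : R) : cutoff x = Num.max (-1) (Num.min 1 x).
Proof.
rewrite /cutoff ler_norml; case: ifPn => [/andP[x1 x2]|].
  by rewrite min_r// max_r.
rewrite negb_and -!ltNge => /orP[x1|x1].
  rewrite ltr0_sg ?(lt_trans x1)// ?ltrN10// min_r ?max_l// ?ltW//.
  by rewrite (lt_trans x1)// gtrN.
by rewrite gtr0_sg ?(lt_trans _ x1)// min_l ?max_r// ?ltW// gtrN.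
Qed.

Lemma cutoff_bounds (x : R) : -1 <= cutoff x <= 1.
Proof. by rewrite cutoffE le_max lexx ge_max ge_min lexx /= andbT; lra. Qed.

Lemma measurable_cutoff : measurable_fun setT (@cutoff R).
Proof.
rewrite (_ : @cutoff R = fun x => Num.max (-1) (Num.min 1 x)); last first.
  by apply/funext => x; rewrite cutoffE.
by apply: measurable_maxr => //; exact: measurable_minr.
Qed.

Lemma measurable_sigma : measurable_fun setT (sigma p).
Proof.
have mr : measurable_fun setT (rho p).
  apply: measurable_funD => //; apply: measurable_funM => //.
  exact: measurable_cutoff.
apply: (measurableT_comp _ mr).
exact: continuous_measurable_fun (@sqrt_continuous R).
Qed.

Lemma sigma_bounded (x : R) : sigma p x ^+ 2 <=
  `|(rho1 p - rho2 p) / (2 * rhor p)| + `|(rho1 p + rho2 p) / (2 * rhor p)|.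
Proof.
rewrite /sigma; have [r0|r0] := leP 0 (rho p x); last first.
  by rewrite (ler0_sqrtr (ltW r0)) expr0n /= addr_ge0.
rewrite sqr_sqrtr// (le_trans (ler_norm _))// (le_trans (ler_normD _ _))//.
rewrite lerD2r normrM ler_piMr// ler_norml; exact: cutoff_bounds.
Qed.

(** The cut-off keeps the order parameter in [-1, 1], where the viscosity
    interpolates between two positive values. *)
Lemma eta_ge0 (x : R) : 0 <= eta p x.
Proof.
have [_ _ [e1 e2 er] _ _] := pok; have /andP[c1 c2] := cutoff_bounds x.
rewrite /eta mulrAC -mulrDl divr_ge0//; last by rewrite mulr_ge0// ltW.
nra.
Qed.

Lemma varrho_gt0 : 0 < varrho p.
Proof. by have [_ [r1 r2 r3] _ _ _] := pok; rewrite divr_gt0// lt_min r1. Qed.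

End coefficient_bounds.

Section state.
Context {R : realType} {d : nat} (Om : set 'rV[R]_d) (p : params R).
Notation E := 'rV[R]_d.
Hypotheses (mOm : measurable Om) (pok : params_ok p).

(** Square root of density times velocity, order parameter, velocity and the
    two scalar auxiliary variables.  The first component is kept apart from the
    velocity because the density it is weighted with changes from one level to
    the next, so that it has a backward difference of its own. *)
Definition state : Type :=
  ((E -> E) * sfield R d * vfield R d * R^o * R^o)%type.

Definition state_dom : set state :=
  [set x | [/\ L2m Om x.1.1.1.1, L2 Om x.1.1.1.2.1, L2m Om (grad x.1.1.1.2)
             & L2m Om (jac x.1.1.2)]].

(** Twice the energy of the scheme without its pressure part, as a bilinear
    form. *)
Definition state_form (x y : state) : R :=
  ipm Om x.1.1.1.1 y.1.1.1.1
  + Cn p / We p * ipm Om (grad x.1.1.1.2) (grad y.1.1.1.2)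
  + ss p / (We p * Cn p) * ip Om x.1.1.1.2.1 y.1.1.1.2.1
  + 2 / (We p * Cn p) * (x.1.2 * y.1.2)
  + x.2 * y.2
  + zeta p * ip Om (div x.1.1.2) (div y.1.1.2).

Definition state_div (x : state) : E -> R^o := div x.1.1.2.

Lemma div_lin (a : R) (u v : vfield R d) :
  div (a *: u + v) = (fun x => a * div u x + div v x).
Proof.
by apply/funext => x; rewrite /div /jac mxtraceD mxtraceZ.
Qed.

Lemma div_L2 (u : vfield R d) : L2m Om (jac u) -> L2 Om (div u).
Proof. by move=> Lu; apply: L2_sum => // i; exact: Lu. Qed.

Lemma zeta_gt0 : 0 < zeta p.
Proof.
by have [_ _ _ _] := pok; apply: lt_le_trans; rewrite mulr_gt0 ?varrho_gt0.
Qed.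

Lemma state_form_ge0 x :
  0 <= state_form x x - zeta p * ip Om (state_div x) (state_div x).
Proof.
have [[cn pe re we fr] _ _ [s0 S0 t0] _] := pok.
rewrite /state_form addrK.
have sq (a : R) : 0 <= a * a by rewrite -expr2 sqr_ge0.
have wc : 0 <= We p * Cn p by rewrite mulr_ge0// ltW.
apply: addr_ge0; last exact: sq.
apply: addr_ge0; last by rewrite mulr_ge0 ?divr_ge0//; exact: sq.
apply: addr_ge0; last by rewrite mulr_ge0 ?ip_ge0// divr_ge0// ltW.
apply: addr_ge0; first exact: ipm_ge0.
by rewrite mulr_ge0 ?ipm_ge0// divr_ge0// ltW.
Qed.

Lemma state_semi_inner : semi_inner state_dom state_form.
Proof.
have si := ip_semi_inner Om mOm.
have sm m n := ipm_semi_inner Om mOm m n.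
split.
- move=> a x y [x1 x2 x3 x4] [y1 y2 y3 y4].
  by split; [have := si_closed (sm _ _) a _ _ x1 y1
    |have := si_closed si a _ _ x2 y2 |have := si_closed (sm _ _) a _ _ x3 y3
    |have := si_closed (sm _ _) a _ _ x4 y4].
- move=> x y; rewrite /state_form [ipm _ x.1.1.1.1 _](si_sym (sm _ _)).
  rewrite [ipm _ (grad _) _](si_sym (sm _ _)) [ip _ x.1.1.1.2.1 _](si_sym si).
  by rewrite [ip _ (div _) _](si_sym si) [x.1.2 * _]mulrC [x.2 * _]mulrC.
- move=> a x y z [x1 x2 x3 x4] [y1 y2 y3 y4] [z1 z2 z3 z4].
  rewrite /state_form.
  have -> := si_lin (sm _ _) a _ _ _ x1 y1 z1.
  have -> := si_lin (sm _ _) a _ _ _ x3 y3 z3.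
  have -> := si_lin si a _ _ _ x2 y2 z2.
  rewrite [div _ in X in _ + _ * X = _]div_lin.
  have -> := si_lin si a _ _ _ (div_L2 _ x4) (div_L2 _ y4) (div_L2 _ z4).
  rewrite /= /GRing.scale /=; ring.
- move=> x _; have := state_form_ge0 x.
  have := mulr_ge0 (ltW zeta_gt0) (ip_ge0 Om (state_div x)); lra.
Qed.

End state.

(** * The energy balance of a time step *)

(** The algebra of the energy balance.  Convection of the order parameter [a],
    capillary force [c], the nonlinear potential [dG] and inertia [B] occur in
    the tested equations with the same auxiliary factors as in the equations
    of the auxiliary variables, hence they cancel; only the pressure work [P]
    remains. *)
Lemma cancel_coupling_terms (R : realType) (U r q ex cn we pe s z v T
    k g f a c m dG dv B P : R) : 0 < cn -> 0 < we ->
  r / U * a - pe^-1 * m = cn ^+ 2 * g + s * f + r / U * dG ->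
  k + z * dv + v
    = - (ex * q / 2) * B + P - r / U / (we * cn) * c ->
  k + cn / we * g + s / (we * cn) * f
  + 2 / (we * cn) * ((2 * U)^-1 * (dG - a + c) * r)
  + (- (q / T) + 2^-1 * ex * B) * q + z * dv
  + (v + T^-1 * q ^+ 2 + (pe * we * cn)^-1 * m) = P.
Proof.
move=> cn0 we0 hmu hu.
have -> : (2 * U)^-1 = 2^-1 * U^-1 by rewrite invfM.
have -> : (pe * we * cn)^-1 = pe^-1 * (we * cn)^-1 by rewrite -mulrA invfM.
have hg : cn / we * g + s / (we * cn) * f
    = (we * cn)^-1 * (cn ^+ 2 * g + s * f).
  by field; rewrite !gt_eqF.
have {}hmu : cn ^+ 2 * g + s * f = r / U * a - pe^-1 * m - r / U * dG.
  by rewrite hmu addrK.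
rewrite hmu in hg; lra.
Qed.

Section balance.
Context {R : realType} {d : nat} (Om : set 'rV[R]_d) (p : params R).
Notation E := 'rV[R]_d.
Hypotheses (mOm : measurable Om) (pok : params_ok p).
Variables (force : R -> E -> E) (tau : R) (fe : fe_spaces R d)
  (w : discrete_sol R d).
Hypothesis Vcl : forall (a : R) u v, Vh fe u -> Vh fe v -> Vh fe (a *: u + v).

Definition state_at (n : nat) : state (R := R) (d := d) :=
  (su p w n, phi w n, vel w n, Rn w n, Qn w n).

(** The physical dissipation; the numerical dissipation by pressure increments
    comes from the pressure update instead. *)
Definition diss_rate (n : nat) : R :=
  2 / Rey p
    * nrmm Om (fun x => Num.sqrt (etat p w n x) *: symgrad (vel w n) x) ^+ 2
  + (TT p)^-1 * Qn w n ^+ 2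
  + (Pe p * We p * Cn p)^-1 * nrmm Om (grad (mu w n)) ^+ 2.

Lemma diss_rate_ge0 n : 0 <= diss_rate n.
Proof.
have [[cn pe re we fr] _ _ [s0 S0 t0] _] := pok.
rewrite /diss_rate; apply: addr_ge0; first apply: addr_ge0.
- by rewrite mulr_ge0 ?sqr_ge0// divr_ge0// ltW.
- by rewrite mulr_ge0 ?sqr_ge0// invr_ge0 ltW.
- by rewrite mulr_ge0 ?sqr_ge0// invr_ge0 !mulr_ge0// ltW.
Qed.

Lemma ipm_scale_sqrt m n (c : E -> R) (f : E -> 'M[R]_(m, n)) :
  (forall x, 0 <= c x) ->
  ipm Om (fun x => c x *: f x) f
  = nrmm Om (fun x => Num.sqrt (c x) *: f x) ^+ 2.
Proof.
move=> c0; rewrite nrmm_sqr; apply: eq_Rintegral => x _.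
apply: eq_bigr => i _; apply: eq_bigr => j _; rewrite !mxE.
by rewrite mulrACA -expr2 sqr_sqrtr// mulrA.
Qed.

Lemma ipm_scale_shift m n (c : E -> R) (f g : E -> 'M[R]_(m, n)) :
  ipm Om (fun x => c x *: f x) g = ipm Om f (fun x => c x *: g x).
Proof.
apply: eq_Rintegral => x _; apply: eq_bigr => i _; apply: eq_bigr => j _.
by rewrite !mxE mulrCA mulrA.
Qed.

Lemma dtau_state_at J n : dtau tau J state_at n =
  (dtau tau J (su p w) n, dtau tau J (phi w) n, dtau tau J (vel w) n,
   dtau tau J (Rn w) n, dtau tau J (Qn w) n).
Proof. by case: J. Qed.

(** The equations are tested with the new chemical potential, the backward
    difference of the order parameter and the new velocity; those of the
    auxiliary variables are multiplied by the new values.  This is valid for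
    both backward differences and any pressure on the right-hand side. *)
Lemma energy_balance J Psharp gP n :
  Vh fe (phi w n) -> Vh fe (phi w n.-1) ->
  L2m Om (ft p force w n.+1) -> L2m Om (vel w n.+1).1 ->
  {ae lebesgue_rV d, forall x, Om x -> ft p force w n.+1 x = 0} ->
  AC_step Om p force tau fe w J Psharp gP n ->
  state_form Om p (dtau tau J state_at n) (state_at n.+1) + diss_rate n.+1
  = ip Om Psharp (div (vel w n.+1)).
Proof.
move=> V1 V0 Lf Lu f0 [[V2 M2 X2 N2] [[hphi hmu hR] [hu _ hQ]]].
have [[cn pe re we fr] _ _ [s0 S0 t0] _] := pok.
have hphi' := hphi _ M2.
have hmu' := hmu _ (dtau_subspace _ Vcl tau J (phi w) n V2 V1 V0).
have hu' := hu _ X2.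
rewrite (ipm_ae0 Om mOm _ _ _ _ Lf Lu f0) mulr0 addr0 in hu'.
rewrite [X in _ + 2 / _ * X]ipm_scale_sqrt in hu'; last first.
  by move=> x; exact: eta_ge0.
rewrite [X in X + zeta p * _ + _]ipm_scale_shift in hu'.
have ic (f g : E -> R) : ip Om f g = ip Om g f.
  by apply: eq_Rintegral => x _; rewrite mulrC.
rewrite ic hphi' -nrmm_sqr in hmu'.
rewrite [X in Cn p ^+ 2 * X]ipm_sym [X in ss p * X]ic in hmu'.
rewrite dtau_state_at.
have := cancel_coupling_terms _ _ _ _ _ _ _ _ _ _ _ (TT p) _ _ _ _ _ _ _ _ _ _
  cn we hmu' hu'.
by rewrite -hR -hQ.
Qed.

End balance.

(** * Discrete solutions *)

Section finite_element_regularity.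
Context {R : realType} {d : nat} (Om : set 'rV[R]_d) (p : params R).
Hypothesis mOm : measurable Om.
Variables (fe : fe_spaces R d) (cqu C0 : R) (w : discrete_sol R d).
Hypothesis conf : conforming Om fe cqu C0.

Lemma Vh_subspace (a : R) u v : Vh fe u -> Vh fe v -> Vh fe (a *: u + v).
Proof. by case: conf => _ [[_ cl _] _] _ _ _; exact: cl. Qed.

Lemma Vh_L2 v : Vh fe v -> L2 Om v.1 /\ L2m Om (grad v).
Proof. by case: conf => _ [_ H] _ _ _ /H[[]]. Qed.

Lemma Xh_L2 v : Xh fe v -> L2m Om v.1 /\ L2m Om (jac v).
Proof.
case: conf => _ _ [_ H] _ _ Xv; split => i j.
  by have [[[L _ _] _] _] := H _ Xv j; rewrite ord1.
have [[[_ L _] _] _] := H _ Xv i; have := L 0 j.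
by congr (L2 _ _); apply/funext => x; rewrite /grad /vcomp /= mxE.
Qed.

Definition pressures : set ('rV[R]_d -> R^o) := [set q.1 | q in Nh fe].

Lemma pressures_subspace (a : R) u v :
  pressures u -> pressures v -> pressures (a *: u + v).
Proof.
case: conf => _ _ _ [[_ cl _] _] _ [q Nq <-] [r Nr <-].
by exists (a *: q + r) => //; exact: cl.
Qed.

Lemma pressures_L2 : pressures `<=` L2 Om.
Proof. by case: conf => _ _ _ [_ H] _ _ [q /H[[]] ? _ _ _ <-]. Qed.

(** The weighted velocity is square-integrable because the density is a bounded
    measurable function of the extrapolated order parameter, which involves
    earlier levels. *)
Lemma state_at_dom n : (forall k, (k <= n)%N -> Vh fe (phi w k)) ->
  Xh fe (vel w n) -> state_dom Om (state_at p w n).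
Proof.
move=> Vphi Xvel; have [Lu Lj] := Xh_L2 _ Xvel.
have [Lphi Lgrad] := Vh_L2 _ (Vphi _ (leqnn n)).
split => //= i j.
have [[mphi _] _] := Vh_L2 _ (tilde_subspace _ Vh_subspace _ _ Vphi).
have ms : measurable_fun Om (sigmat p w n).
  exact: measurableT_comp (measurable_sigma p) mphi.
have := L2_bounded_mul _ mOm _ _ _ ms (fun x => sigma_bounded p _) (Lu i j).
by congr (L2 _ _); apply/funext => x; rewrite /su mxE.
Qed.

End finite_element_regularity.

Section energy_terms.
Context {R : realType} {d : nat} (Om : set 'rV[R]_d) (p : params R).
Variables (tau : R) (w : discrete_sol R d).

Lemma energyE n : energy Om p tau w n =
  1 / 2 * state_form Om p (state_at p w n) (state_at p w n)
  + 2 / 9 * (tau ^+ 2 / varrho p * ip Om (prs w n).1 (prs w n).1).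
Proof.
rewrite /energy /state_form /= !nrmm_sqr !nrm_sqr !real_normK ?num_real//.
rewrite !invfM.
lra.
Qed.

Lemma dissipationE n : dissipation Om p tau w n =
  2 / 3 * diss_rate Om p w n
  + 2 / 9 * (tau / varrho p * ip Om (prs w n.-1 - prs w n.-2).1
                                    (prs w n.-1 - prs w n.-2).1).
Proof.
rewrite /dissipation /diss_rate !nrmm_sqr nrm_sqr real_normK ?num_real//.
rewrite !invfM; lra.
Qed.

End energy_terms.

(** The state at level 0 in terms of the initial data alone, so that the bound
    can be stated before the mesh, the time step and the solution are given. *)
Definition initial_state {R : realType} {d : nat} (Om : set 'rV[R]_d)
    (p : params R) (i : initdata R d) : state (R := R) (d := d) :=
  (fun x => sigma p ((phi_init i).1 x) *: (u_init i).1 x,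
   phi_init i, u_init i, U Om p (phi00 i), 1).

Theorem theorem5 (R : realType) (d : nat) (Om : set 'rV[R]_d) (p : params R)
    (init : initdata R d) :
  d = 2%N \/ d = 3%N ->
  lipschitz_domain Om ->
  params_ok p ->
  0 < GS Om p (phi00 init) ->
  exists C : R,
  forall (fe : fe_spaces R d) (cqu C0 : R),
    0 < cqu -> 0 < C0 -> conforming Om fe cqu C0 ->
    init_in_spaces fe init ->
  forall (force : R -> 'rV[R]_d -> 'rV[R]_d) (tau : R) (K : nat)
         (w : discrete_sol R d),
    0 < tau -> (0 < K)%N -> K%:R * tau = TT p ->
    starts_at Om p init w ->
    (forall n, (n < K)%N -> 0 < GS Om p (phit w n.+1)) ->
    (forall n, (n < K)%N -> AC2_step Om p force tau fe w n) ->
    (forall n, (n < K)%N -> L2m Om (ft p force w n.+1) /\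
      {ae lebesgue_rV d, forall x, Om x -> ft p force w n.+1 x = 0}) ->
  forall N : nat, (2 <= N)%N -> N%:R * tau <= TT p ->
    energy Om p tau w N
    + tau * \sum_(2 <= k < N.+1) dissipation Om p tau w k <= C.
Proof.
move=> _ [_ oOm _ _ _] pok _.
pose X0 := initial_state Om p init.
exists (500 * state_form Om p X0 X0
  + 600 * (TT p ^+ 2 / varrho p * ip Om (P_init init).1 (P_init init).1)).
move=> fe cqu C0 _ _ conf [Vphi0 _ Xu0 NP0] force tau K w tau0 K0 KT.
move=> [phi0 _ vel0 prs0 [R0 Q0]] _ AC f0 N N2 NT.
have mOm := open_measurable_mx _ _ _ _ oOm.
have rho0 := varrho_gt0 p pok.
have tauT : tau <= TT p.
  by rewrite -KT ler_peMl ?(ltW tau0)// ler1n.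
have NK : (N <= K)%N by move: NT; rewrite -KT ler_pM2r// ler_nat.
have Vphi n : (n <= K)%N -> Vh fe (phi w n).
  by case: n => [|n] nK; [rewrite phi0|case: (AC _ nK) => -[]].
have Xvel n : (n <= K)%N -> Xh fe (vel w n).
  by case: n => [|n] nK; [rewrite vel0|case: (AC _ nK) => -[]].
have Nprs n : (n <= K)%N -> pressures fe (prs w n).1.
  move=> nK; exists (prs w n) => //.
  case: n nK => [|n] nK; first by rewrite prs0.
  by case: (AC _ nK) => -[].
have -> : X0 = state_at p w 0.
  rewrite /X0 /state_at /initial_state -R0 -Q0 -phi0 -vel0.
  congr (_, _, _, _, _).
rewrite -prs0.
have balance n : (n < K)%N ->
    state_form Om p (dtau tau (bdf_at n) (state_at p w) n) (state_at p w n.+1)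
    + diss_rate Om p w n.+1
    = ip Om (pressure_ext (fun k => (prs w k).1 : _ -> R^o) n)
        (state_div (state_at p w n.+1)).
  move=> nK; have [Lf fae] := f0 _ nK.
  have [Lu _] := Xh_L2 _ _ _ _ conf _ (Xvel _ nK).
  rewrite (energy_balance Om p mOm pok force tau fe w
    (Vh_subspace _ _ _ _ conf) _ _ _ _ (Vphi _ (ltnW nK))
    (Vphi _ (leq_trans (leq_pred n) (ltnW nK))) Lf Lu fae (AC _ nK)).
  by case: n {nK Lf fae Lu} => [|[|n]].
have stab := projection_stability (state_dom Om) (state_form Om p)
  (L2 Om) (ip Om) (pressures fe) (@state_div R d)
  (state_semi_inner Om p mOm pok) (ip_semi_inner Om mOm)
  (pressures_L2 _ _ _ _ conf) (pressures_subspace _ _ _ _ conf).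
have := stab _ _ (varrho p) tau rho0 tau0 _ (TT p) (state_at p w)
  (fun k => (prs w k).1) (diss_rate Om p w) K tauT _ Nprs
  (diss_rate_ge0 Om p pok w) balance _ N _.
rewrite energyE (eq_bigr _ (fun k _ => dissipationE _ _ _ _ k)).
apply.
- by move=> a u v; exact: div_lin.
- by move=> u [_ _ _ /(div_L2 _ mOm)].
- move=> u _; have := state_form_ge0 Om p pok u.
  have [_ _ _ _ rz] := pok.
  have := ler_wpM2r (ip_ge0 Om (state_div u)) rz; lra.
- move=> n nK; apply: state_at_dom conf _ _ _ => //; last exact: Xvel.
  by move=> k kn; apply: Vphi; exact: leq_trans nK.
- move=> n _ nK [q Nq <-].
  by have [_ [_ [_ hP _]]] := AC _ nK; exact: (hP _ Nq).
- by rewrite N2.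
Qed.
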